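(* Let $0<p<1/2$. There exists a finite positive measure $\mu$ supported on a closed set $E\subset\partial\mathbb{D}$ of zero length whose complementary arcs $\{J\}$ satisfy $$\sum_J|J|^{1-\frac{p}{1-p}}<\infty,$$ yet $S_\mu'\notin H^p$.
   Context: $\mathbb{D}$ is the open unit disk, $\partial\mathbb{D}$ the unit circle, $|J|$ is the length of an arc $J$, and $H^p$ is the Hardy space on $\mathbb{D}$. The complementary arcs of $E$ are the connected components of $\partial\mathbb{D}\setminus E$. For a finite positive singular measure $\mu$ on $\partial\mathbb{D}$, the singular inner function is $$S_\mu(z)=\exp\Bigl(-\int_{\partial\mathbb{D}}\frac{\zeta+z}{\zeta-z}\,d\mu(\zeta)\Bigr),\qquad |z|<1.$$ *)

(* Defs.v *)
From HB Require Import structures.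
From mathcomp Require Import all_boot all_order all_algebra.
From mathcomp Require Export complex.
From mathcomp Require Import all_classical all_reals all_analysis.
Set Implicit Arguments.
Unset Strict Implicit.
Unset Printing Implicit Defensive.
Import Order.TTheory GRing.Theory Num.Theory numFieldNormedType.Exports.
Local Open Scope classical_set_scope.
Local Open Scope ring_scope.
Local Open Scope complex_scope.

(* R[i] carries its norm topology, and its normed module structure over itself,
   through the alias R[i]^o; derivable and derive1 on it are therefore complex
   differentiability and the complex derivative. *)
Notation Cplx R := (R[i]^o) (only parsing).

Definition borelC (R : realType) := g_sigma_algebraType (@open (Cplx R)).

Section complex_plane.
Variable R : realType.
Implicit Types (z : R[i]) (t : R).

Definition cabs z : R := complex.Re `|z|.

Definition cexp z : R[i] :=
  (expR (complex.Re z) * cos (complex.Im z))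
    +i* (expR (complex.Re z) * sin (complex.Im z)).

Definition cis t : R[i] := cexp (0 +i* t).

Definition unit_disk : set (Cplx R) := [set z | cabs z < 1].

Definition unit_circle : set (Cplx R) := [set z | cabs z = 1].

(* length of a subset of the unit circle; t |-> cis t is a bijection from
   [0, 2 pi[ onto the circle *)
Definition arc_length (J : set (Cplx R)) : \bar R :=
  lebesgue_measure [set t : R | (0 <= t < 2 * pi) /\ J (cis t)].

Definition complementary_arcs (E : set (Cplx R)) : set (set (Cplx R)) :=
  connected_component (unit_circle `\` E) @` (unit_circle `\` E).

Definition Cintegral d (T : measurableType d)
    (mu : {measure set T -> \bar R}) (D : set T) (f : T -> R[i]) : R[i] :=
  (\int[mu]_(x in D) complex.Re (f x)) +i* (\int[mu]_(x in D) complex.Im (f x)).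

(* meaningful for z in the unit disk *)
Definition singular_inner (mu : {measure set (borelC R) -> \bar R}) :
    R[i] -> Cplx R :=
  fun z => cexp (- Cintegral mu unit_circle (fun w => (w + z) / (w - z))).

Definition holomorphic_on (U : set (Cplx R)) (f : R[i] -> Cplx R) :=
  forall z : Cplx R, U z -> derivable (f : Cplx R -> Cplx R) z 1.

Definition hardy_mean (p : R) (f : R[i] -> Cplx R) (r : R) : \bar R :=
  (((2 * pi)^-1)%:E *
    \int[lebesgue_measure]_(t in `[0%R, (2 * pi)%R])
      (cabs (f (r%:C * cis t)) `^ p)%:E)%E.

Definition Hardy (p : R) (f : R[i] -> Cplx R) : Prop :=
  holomorphic_on unit_disk f /\
  (ereal_sup (hardy_mean p f @` [set r : R | (0 <= r < 1)%R]) < +oo)%E.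

End complex_plane.

(* Main.v *)
Require Import Defs.
From HB Require Import structures.
From mathcomp Require Import all_boot all_order all_algebra.
From mathcomp Require Import all_classical all_reals all_analysis.
From mathcomp Require Import measurable_realfun.
From mathcomp Require Import zify ring lra.
Import Order.TTheory GRing.Theory Num.Theory numFieldNormedType.Exports.
Local Open Scope classical_set_scope.
Local Open Scope ring_scope.
Local Open Scope complex_scope.
Set Implicit Arguments.
Unset Strict Implicit.
Unset Printing Implicit Defensive.

(** The measure lives on a Cantor set that is read off from an increasing pure
   jump function [f] on [[0, 1]].  At stage [j] the function jumps by [l_j] at
   each of the [N_j = 2^(b j)] odd multiples of [1 / (2 N_j)]; the total jumps
   [T_j = N_j l_j] at least halve from one stage to the next.  The set [E]
   consists of the points of the circle whose arguments are not skipped by [f],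
   and [mu] is the image of Lebesgue measure on [[0, 1]] under
   [x |-> e^(i f x)].  As [f] increases by jumps only, [E] has length zero; its
   complementary arcs are the [N_j] jumps of each stage and one further arc that
   closes the circle, so that [sum |J|^s] is [sum_j N_j l_j^s] up to one term.

   Consider a gap of stage [j], the image of a jump at [x].  The next
   [1 / (2 N_j)] units of Lebesgue measure to the right of [x] meet no jump of
   stage [j] or earlier, so the mass [1 / (2 N_j)] sits within a distance
   comparable with [l_j] of the gap ([jump_fun_near], [mass_near_gap]).  On the
   circle [|S'(z)|] is [2 int |w - z|^(-2) dmu(w)], which in the middle half of
   the gap is therefore at least a constant times [1 / (N_j l_j^2)].  The [N_j]
   gaps of stage [j] together contribute to the integral of [|S'|^p] at least a
   constant times

     [N_j l_j (N_j l_j^2)^(- p) = (N_j l_j^s)^(1 - p)],  [s = 1 - p / (1 - p)].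

   The choice [N_j l_j^s = (j + 1)^(- 1 / (1 - p))] makes [sum |J|^s] finite and
   turns the contributions into the harmonic series.  The same mass is used anew
   at every stage; if every gap had its own share of the mass, the inequality of
   Hoelder would bound the sum of the contributions.

   The passage from the circle to the disk is quantitative rather than a limit.
   One has [S' = - S K] with [K(z) = int 2 w / (w - z)^2 dmu(w)]
   ([derive1_singular_inner]).  If [x] is a point of the circle at distance at
   least [sqrt e] from [E], and [1 - r] is at most [1 / 2] and [e / 4], then
   [|S(r x)|] is bounded below and the integrand of [- r x K(r x)] has a real
   part of at least a constant times [|w - x|^(-2)]
   ([cabs_derive1_singular_inner_ge]).  Finitely many stages keep
   a positive distance from [E] on the middle halves of their gaps, so for each
   partial sum of the harmonic series one radius [r] gives a mean of [|S'|^p]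
   that exceeds a fixed multiple of it. *)

(** * Modulus, exponential and complex derivative *)

Section modulus.
Variable R : realType.
Implicit Types z w : R[i].

Lemma cabsE z : (cabs z)%:C = `|z|.
Proof. by rewrite /cabs normc_def. Qed.

Lemma cabs_ge0 z : 0 <= cabs z.
Proof. by rewrite -ler0c cabsE normr_ge0. Qed.

Lemma cabsM z w : cabs (z * w) = cabs z * cabs w.
Proof. by apply: complexI; rewrite rmorphM /= !cabsE normrM. Qed.

Lemma cabsV z : cabs z^-1 = (cabs z)^-1.
Proof. by apply: complexI; rewrite fmorphV /= !cabsE normfV. Qed.

Lemma cabsN z : cabs (- z) = cabs z.
Proof. by apply: complexI; rewrite !cabsE normrN. Qed.

Lemma cabs_eq0 z : (cabs z == 0) = (z == 0).
Proof. by rewrite -(inj_eq (@complexI R)) cabsE normr_eq0. Qed.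

Lemma ler_cabsD z w : cabs (z + w) <= cabs z + cabs w.
Proof. by rewrite -lecR rmorphD /= !cabsE ler_normD. Qed.

Lemma cabs_real (x : R) : cabs x%:C = `|x|.
Proof. by rewrite /cabs normc_def /= expr0n addr0 sqrtr_sqr. Qed.

Lemma sqr_cabs z : cabs z ^+ 2 = complex.Re z ^+ 2 + complex.Im z ^+ 2.
Proof. by apply: complexI; rewrite add_Re2_Im2 rmorphXn /= cabsE. Qed.

Lemma ler_Re_cabs z : `|complex.Re z| <= cabs z.
Proof. by rewrite -lecR cabsE normc_ge_Re. Qed.

Lemma ler_Im_cabs z : `|complex.Im z| <= cabs z.
Proof.
rewrite -[leLHS]ger0_norm// -ler_sqr ?nnegrE ?cabs_ge0// normr_id.
by rewrite real_normK ?num_real// sqr_cabs lerDr sqr_ge0.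
Qed.

Lemma ler_cabs_ReIm z : cabs z <= `|complex.Re z| + `|complex.Im z|.
Proof.
rewrite -ler_sqr ?nnegrE ?cabs_ge0 ?addr_ge0// sqr_cabs sqrrD.
rewrite !real_normK ?num_real//.
by have := mulr_ge0 (normr_ge0 (complex.Re z)) (normr_ge0 (complex.Im z)); lra.
Qed.

Lemma cabs_sub_ge z w : cabs z - cabs w <= cabs (z - w).
Proof. by have := ler_cabsD (z - w) w; rewrite subrK; lra. Qed.

Lemma cabs_subC z w : cabs (z - w) = cabs (w - z).
Proof. by rewrite -cabsN opprB. Qed.

End modulus.

Section exponential.
Variable R : realType.
Implicit Types (z w : R[i]) (t : R).

Lemma cexpD z w : cexp (z + w) = cexp z * cexp w.
Proof.
case: z => a b; case: w => c d; rewrite /cexp /= expRD cosD sinD.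
by congr Complex; ring.
Qed.

Lemma cabs_cexp z : cabs (cexp z) = expR (complex.Re z).
Proof.
apply/eqP; rewrite -(@eqrXn2 _ 2) ?cabs_ge0 ?expR_ge0// sqr_cabs /=.
by rewrite !exprMn -mulrDr cos2Dsin2 mulr1.
Qed.

Lemma cisE t : cis t = cos t +i* sin t.
Proof. by rewrite /cis /cexp /= expR0 !mul1r. Qed.

Lemma cabs_cis t : cabs (cis t) = 1.
Proof. by rewrite cabs_cexp /= expR0. Qed.

Lemma mean_value_at0 (f df : R -> R) (y : R) :
  (forall x : R, is_derive x 1 f (df x)) ->
  exists2 c, `|c| <= `|y| & f y - f 0 = df c * y.
Proof.
move=> fdf.
have cf a b : {within `[a, b], continuous f}.
  apply: derivable_within_continuous => x _; exact: ex_derive.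
have [y0|y0] := leP 0 y.
  have [c] := MVT_segment y0 (fun x _ => fdf x) (cf _ _).
  rewrite in_itv /= => /andP[c0 cy] ->; exists c; last by rewrite subr0.
  by rewrite !ger0_norm.
have [c] := MVT_segment (ltW y0) (fun x _ => fdf x) (cf _ _).
rewrite in_itv /= => /andP[c0 cy] e; exists c; last first.
  by rewrite -opprB e sub0r mulrN opprK.
by rewrite !ler0_norm ?(ltW y0)// lerN2.
Qed.

Lemma ler_norm_sin t : `|sin t| <= `|t|.
Proof.
have [c _] := mean_value_at0 t (@is_derive_sin R).
by rewrite sin0 subr0 => ->; rewrite normrM ler_piMl// cos_max.
Qed.

Lemma ler_norm_1Bcos t : `|1 - cos t| <= t ^+ 2.
Proof.
have [c ct] := mean_value_at0 t (@is_derive_cos R).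
rewrite cos0 distrC => ->.
rewrite normrM normrN -[t ^+ 2]real_normK ?num_real//.
by rewrite expr2 ler_wpM2r// (le_trans (ler_norm_sin _)).
Qed.

Lemma ler_norm_sinB t : `|t| <= 1 -> `|sin t - t| <= t ^+ 2.
Proof.
move=> t1; have D (x : R) : is_derive x 1 (fun u : R => sin u - u) (cos x - 1).
  by apply: is_deriveB.
have [c ct] := mean_value_at0 t D; rewrite sin0 !subr0 => ->.
rewrite normrM -[t ^+ 2]real_normK ?num_real// expr2 ler_wpM2r//.
rewrite distrC (le_trans (ler_norm_1Bcos _))// -real_normK ?num_real//.
by rewrite (le_trans _ ct)// expr2 ler_piMl// (le_trans ct).
Qed.

Lemma expR_taylor1 t : `|t| <= 2^-1 -> 0 <= expR t - 1 - t <= 2 * t ^+ 2.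
Proof.
rewrite ler_norml => /andP[t1 t2]; apply/andP; split.
  by have := expR_ge1Dx t; lra.
have := expR_ge1Dx (- t); rewrite expRN => h.
have t3 : 0 < 1 - t by lra.
have : expR t <= (1 - t)^-1.
  by rewrite -[leLHS]invrK lef_pV2 // posrE invr_gt0 expR_gt0.
move=> /le_trans h2; suff : (1 - t)^-1 <= 1 + t + 2 * t ^+ 2 by move=> /h2; lra.
rewrite -[leLHS]mul1r ler_pdivrMr//.
have -> : (1 + t + 2 * t ^+ 2) * (1 - t) = 1 + t ^+ 2 * (1 - 2 * t) by ring.
by rewrite lerDl mulr_ge0 ?sqr_ge0//; lra.
Qed.

(** The error term of the first order expansion of the exponential; it yields
   the complex derivative of a function of the form [cexp \o g]. *)
Lemma cexp_taylor1 z : cabs z <= 2^-1 ->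
  cabs (cexp z - 1 - z) <= 9 * cabs z ^+ 2.
Proof.
case: z => x y z1.
have x1 : `|x| <= 2^-1 by exact: le_trans (ler_Re_cabs _) z1.
have y1 : `|y| <= 2^-1 by exact: le_trans (ler_Im_cabs _) z1.
rewrite (le_trans (ler_cabs_ReIm _))// sqr_cabs /=.
have /andP[e0 e2] := expR_taylor1 x1.
have c1 := ler_norm_1Bcos y; have s1 := ler_norm_sin y.
have s2 : `|sin y - y| <= y ^+ 2 by apply: ler_norm_sinB; lra.
have x2 : x ^+ 2 <= 2^-1 * `|x|.
  by rewrite -real_normK ?num_real// expr2 ler_wpM2r.
have ex1 : `|expR x - 1| <= 2 * `|x|.
  have -> : expR x - 1 = (expR x - 1 - x) + x by ring.
  by rewrite (le_trans (ler_normD _ _))// (ger0_norm e0); lra.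
have -> : expR x * cos y - 1 - x
   = (expR x - 1 - x) * cos y - (1 + x) * (1 - cos y) by ring.
have -> : expR x * sin y - 0 - y = (expR x - 1) * sin y + (sin y - y) by ring.
have A : `|(expR x - 1 - x) * cos y| <= 2 * x ^+ 2.
  by rewrite normrM (ger0_norm e0) (le_trans _ e2)// ler_piMr// cos_max.
have B : `|(1 + x) * (1 - cos y)| <= 2 * y ^+ 2.
  rewrite normrM ler_pM// (le_trans (ler_normD _ _))// normr1; lra.
have D : `|(expR x - 1) * sin y| <= 2 * `|x| * `|y| by rewrite normrM ler_pM.
have F : 2 * `|x| * `|y| <= x ^+ 2 + y ^+ 2.
  rewrite -[x ^+ 2]real_normK ?num_real// -[y ^+ 2]real_normK ?num_real//.
  by have := sqr_ge0 (`|x| - `|y|); lra.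
have := ler_normB ((expR x - 1 - x) * cos y) ((1 + x) * (1 - cos y)).
have := ler_normD ((expR x - 1) * sin y) (sin y - y).
have := sqr_ge0 x; have := sqr_ge0 y.
lra.
Qed.

End exponential.

Section topology.
Variable R : realType.

(** The norm of [R[i]] takes values in [R[i]]; its topology is that of the real
   modulus [cabs]. *)
Lemma cvg_Cplx T (F : set_system T) {FF : Filter F} (g : T -> Cplx R)
    (l : Cplx R) :
  (forall e : R, 0 < e -> \forall x \near F, cabs (g x - l) < e) -> g @ F --> l.
Proof.
move=> h; apply/cvgrPdist_lt => e; rewrite ltcE => /andP[/eqP e0 e1].
have e_real : e = (complex.Re e)%:C by case: e e0 {e1} => a b /= ->.
near=> x; rewrite e_real distrC -cabsE ltcR.
by near: x; exact: h.
Unshelve. all: by end_near. Qed.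

Lemma nbhs_cabs (z : Cplx R) (e : R) : 0 < e ->
  \forall w \near z, cabs (z - w) < e.
Proof.
move=> e0; apply/nbhs_normP; exists e%:C; first by rewrite /= ltcR.
by move=> w /=; rewrite -ltcR cabsE.
Qed.

Lemma derive1_Cplx (f : R[i] -> Cplx R) (z A : R[i]) (C d : R) : 0 < d ->
  (forall h, cabs h < d -> cabs (f (h + z) - f z - A * h) <= C * cabs h ^+ 2) ->
  derive1 f z = A.
Proof.
move=> d0 H; apply: cvg_lim; first exact: norm_hausdorff.
apply: cvg_Cplx => e e0.
have C1 : 0 < `|C| + 1 by rewrite ltr_wpDl.
near=> h.
have h0 : h != 0 by near: h; exact: nbhs_dnbhs_neq.
have hd : cabs h < Num.min d (e / (`|C| + 1)).
  near: h; apply: nbhs_dnbhs.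
  apply: filterS (@nbhs_cabs 0 (Num.min d (e / (`|C| + 1))) _) => [w|].
    by rewrite sub0r cabsN.
  by rewrite lt_min d0 divr_gt0.
move: hd; rewrite lt_min => /andP[/H hd he].
have -> : h^-1 *: (f (h + z) - f z) - A = h^-1 * (f (h + z) - f z - A * h).
  by rewrite mulrBr [h^-1 * (A * h)]mulrC mulfK.
have c0 : 0 < cabs h by rewrite lt_neqAle eq_sym cabs_eq0 h0 cabs_ge0.
rewrite cabsM cabsV mulrC ltr_pdivrMr//; apply: le_lt_trans hd _.
rewrite expr2 mulrA ltr_pM2r//.
apply: le_lt_trans (_ : (`|C| + 1) * cabs h < e).
  by rewrite ler_wpM2r ?cabs_ge0// (le_trans (ler_norm _))// lerDl.
by rewrite mulrC -ltr_pdivlMr.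
Unshelve. all: by end_near. Qed.

(** Stated with an explicit quadratic error so that no differentiability of the
   exponent in the sense of limits has to be established first. *)
Lemma derive1_cexp (g : R[i] -> R[i]) (z A : R[i]) (C d : R) : 0 < d ->
  (forall h, cabs h < d -> cabs (g (h + z) - g z - A * h) <= C * cabs h ^+ 2) ->
  derive1 (fun w => cexp (g w) : Cplx R) z = cexp (g z) * A.
Proof.
move=> d0 H.
have C1 : 0 <= `|C| by [].
pose B := cabs A + `|C|.
have B0 : 0 <= B by rewrite addr_ge0 ?cabs_ge0.
pose e := Num.min d (Num.min 1 (2 * (B + 1))^-1).
have e0 : 0 < e by rewrite !lt_min d0 ltr01 invr_gt0 mulr_gt0// ltr_wpDl.
apply: (derive1_Cplx e0 (C := cabs (cexp (g z)) * (9 * B ^+ 2 + `|C|))) => h.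
rewrite !lt_min => /and3P[/H Hh h1 hB].
have h0 := cabs_ge0 h.
have Hh' : cabs (g (h + z) - g z - A * h) <= `|C| * cabs h ^+ 2.
  by rewrite (le_trans Hh)// ler_wpM2r ?sqr_ge0 ?ler_norm.
set u := g (h + z) - g z in Hh'.
have uB : cabs u <= B * cabs h.
  have -> : u = (u - A * h) + A * h by rewrite subrK.
  rewrite (le_trans (ler_cabsD _ _))// cabsM /B mulrDl addrC lerD2l.
  rewrite (le_trans Hh')// ler_wpM2l// expr2 ler_piMr// ltW//.
have u2 : cabs u <= 2^-1.
  rewrite (le_trans uB)//.
  have : (B + 1) * cabs h <= 2^-1.
    have h3 : 0 < B + 1 by rewrite ltr_wpDl.
    rewrite mulrC -ler_pdivlMr// -invfM; exact: ltW.
  by rewrite mulrDl mul1r; lra.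
have -> : g (h + z) = u + g z by rewrite /u subrK.
rewrite cexpD.
have -> : cexp u * cexp (g z) - cexp (g z) - cexp (g z) * A * h =
  cexp (g z) * ((cexp u - 1 - u) + (u - A * h)) by ring.
rewrite cabsM -mulrA ler_wpM2l ?cabs_ge0// mulrDl.
rewrite (le_trans (ler_cabsD _ _))// lerD//.
rewrite (le_trans (cexp_taylor1 u2))// -mulrA ler_wpM2l// -exprMn.
by rewrite lerXn2r// nnegrE ?cabs_ge0 ?mulr_ge0.
Qed.

End topology.

(** * The derivative of a singular inner function *)

Section bounded_measurable.
Context d (T : measurableType d) (R : realType).
Variables (mu : {finite_measure set T -> \bar R}) (D : set T).
Hypothesis mD : measurable D.
Implicit Types f g : T -> R[i].

(** Bounded measurable complex functions on [D], in real coordinates: a class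
   that contains the kernels below and on which [Cintegral] is linear. *)
Definition bmeas f :=
  [/\ measurable_fun D (fun x => complex.Re (f x)),
      measurable_fun D (fun x => complex.Im (f x)) &
      exists M, forall x, D x -> cabs (f x) <= M].

Lemma bmeas_cst (c : R[i]) : bmeas (fun=> c).
Proof. by split; [exact: measurable_cst..|exists (cabs c)]. Qed.

Lemma bmeasD f g : bmeas f -> bmeas g -> bmeas (fun x => f x + g x).
Proof.
move=> [fr fi [M Mf]] [gr gi [N Ng]]; split.
- by under eq_fun do rewrite raddfD; exact: measurable_funD.
- by under eq_fun do rewrite raddfD; exact: measurable_funD.
exists (M + N) => x Dx.
by rewrite (le_trans (ler_cabsD _ _))// lerD ?Mf ?Ng.
Qed.

Lemma bmeasM f g : bmeas f -> bmeas g -> bmeas (fun x => f x * g x).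
Proof.
move=> [fr fi [M Mf]] [gr gi [N Ng]]; split.
- have -> : (fun x => complex.Re (f x * g x)) = (fun x =>
    complex.Re (f x) * complex.Re (g x) - complex.Im (f x) * complex.Im (g x)).
    by apply/funext => x; case: (f x); case: (g x).
  by apply: measurable_funB; exact: measurable_funM.
- have -> : (fun x => complex.Im (f x * g x)) = (fun x =>
    complex.Re (f x) * complex.Im (g x) + complex.Im (f x) * complex.Re (g x)).
    by apply/funext => x; case: (f x); case: (g x).
  by apply: measurable_funD; exact: measurable_funM.
exists (M * N) => x Dx.
by rewrite cabsM ler_pM ?cabs_ge0 ?Mf ?Ng.
Qed.

Lemma bmeasN f : bmeas f -> bmeas (fun x => - f x).
Proof.
move=> hf; have := bmeasM (bmeas_cst (- 1)) hf.
by under eq_fun do rewrite mulN1r.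
Qed.

Lemma bmeasB f g : bmeas f -> bmeas g -> bmeas (fun x => f x - g x).
Proof. by move=> hf hg; apply: bmeasD => //; exact: bmeasN. Qed.

Lemma bmeasV f (e : R) : 0 < e -> (forall x, D x -> e <= cabs (f x)) ->
  bmeas f -> bmeas (fun x => (f x)^-1).
Proof.
move=> e0 fe [fr fi [M Mf]].
have mV : measurable_fun D (fun x =>
    (complex.Re (f x) ^+ 2 + complex.Im (f x) ^+ 2) `^ (- 1)).
  apply: (measurableT_comp (measurable_powR _)).
  by apply: measurable_funD; exact: measurable_funX.
have VE x : D x -> (complex.Re (f x) ^+ 2 + complex.Im (f x) ^+ 2) `^ (- 1) =
    (complex.Re (f x) ^+ 2 + complex.Im (f x) ^+ 2)^-1.
  by move=> Dx; rewrite powR_inv1// -sqr_cabs sqr_ge0.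
split.
- apply: eq_measurable_fun (measurable_funM fr mV) => x; rewrite inE => Dx.
  by rewrite /= VE//; case: (f x).
- apply: eq_measurable_fun (measurable_funM (measurable_funN fi) mV) => x.
  by rewrite inE => Dx /=; rewrite VE//; case: (f x) => a b /=; rewrite mulNr.
exists e^-1 => x Dx; rewrite cabsV lef_pV2 ?fe// posrE (lt_le_trans e0)//.
exact: fe.
Qed.

Lemma bounded_integrable (u : T -> R) (M : R) :
  measurable_fun D u -> (forall x, D x -> `|u x| <= M) ->
  mu.-integrable D (EFin \o u).
Proof.
move=> mu_ uM; apply: measurable_bounded_integrable => //.
  by rewrite ltey_eq fin_num_measure.
exists M; split; first exact: num_real.
by move=> y My x Dx; rewrite /= (le_trans (uM _ Dx))// ltW.
Qed.

Lemma integrable_Re f : bmeas f ->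
  mu.-integrable D (EFin \o (fun x => complex.Re (f x))).
Proof.
move=> [fr _ [M Mf]]; apply: (bounded_integrable (M := M)) => // x Dx.
exact: le_trans (ler_Re_cabs _) (Mf _ Dx).
Qed.

Lemma integrable_Im f : bmeas f ->
  mu.-integrable D (EFin \o (fun x => complex.Im (f x))).
Proof.
move=> [_ fi [M Mf]]; apply: (bounded_integrable (M := M)) => // x Dx.
exact: le_trans (ler_Im_cabs _) (Mf _ Dx).
Qed.

Lemma CintegralD f g : bmeas f -> bmeas g ->
  Cintegral mu D (fun x => f x + g x) = Cintegral mu D f + Cintegral mu D g.
Proof.
move=> hf hg; rewrite /Cintegral.
under eq_Rintegral do rewrite raddfD.
under [X in Complex _ X]eq_Rintegral do rewrite raddfD.
rewrite RintegralD//; [|exact: integrable_Re..].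
by rewrite RintegralD//; exact: integrable_Im.
Qed.

Lemma CintegralZ (c : R[i]) f : bmeas f ->
  Cintegral mu D (fun x => c * f x) = c * Cintegral mu D f.
Proof.
move=> hf; case: c => a b.
have hr := integrable_Re hf; have hi := integrable_Im hf.
have hrZ k : mu.-integrable D (EFin \o (fun x => k * complex.Re (f x))).
  have := integrableZl mD k hr.
  by apply: eq_integrable => // x _; rewrite /= EFinM.
have hiZ k : mu.-integrable D (EFin \o (fun x => k * complex.Im (f x))).
  have := integrableZl mD k hi.
  by apply: eq_integrable => // x _; rewrite /= EFinM.
rewrite /Cintegral.
have -> : (fun x => complex.Re ((a +i* b) * f x)) =
    (fun x => a * complex.Re (f x) - b * complex.Im (f x)).
  by apply/funext => x; case: (f x).
have -> : (fun x => complex.Im ((a +i* b) * f x)) =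
    (fun x => a * complex.Im (f x) + b * complex.Re (f x)).
  by apply/funext => x; case: (f x).
by rewrite RintegralB// RintegralD// !RintegralZl.
Qed.

Lemma CintegralB f g : bmeas f -> bmeas g ->
  Cintegral mu D (fun x => f x - g x) = Cintegral mu D f - Cintegral mu D g.
Proof.
move=> hf hg; rewrite CintegralD//; last exact: bmeasN.
rewrite -mulN1r -CintegralZ//.
by congr (_ + Cintegral _ _ _); apply/funext => x; rewrite mulN1r.
Qed.

Lemma ler_norm_Rintegral_bound (u : T -> R) (M : R) :
  measurable_fun D u -> (forall x, D x -> `|u x| <= M) ->
  `|\int[mu]_(x in D) u x| <= M * fine (mu D).
Proof.
move=> mu_ uM; have hu := bounded_integrable mu_ uM.
rewrite (le_trans (le_normr_Rintegral mD hu))// -Rintegral_cst//.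
apply: le_Rintegral => //.
  by apply: (bounded_integrable (M := M)) => [|x Dx];
    [exact: measurableT_comp|rewrite normr_id uM].
by apply: finite_measure_integrable_cst.
Qed.

Lemma ler_cabs_Cintegral f (M : R) : bmeas f ->
  (forall x, D x -> cabs (f x) <= M) ->
  cabs (Cintegral mu D f) <= 2 * M * fine (mu D).
Proof.
move=> [fr fi _] fM; rewrite (le_trans (ler_cabs_ReIm _))//=.
rewrite -mulrA mulr_natl mulr2n.
by apply: lerD; apply: ler_norm_Rintegral_bound => // x Dx;
  rewrite (le_trans _ (fM _ Dx))// ?ler_Re_cabs ?ler_Im_cabs.
Qed.

End bounded_measurable.

Section borel_circle.
Variable R : realType.
Local Notation C := (Cplx R).

Lemma measurable_borelC_open (A : set C) : open A ->
  measurable (A : set (borelC R)).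
Proof. by move=> oA; apply: sub_sigma_algebra. Qed.

Lemma measurable_borelC_closed (A : set C) : closed A ->
  measurable (A : set (borelC R)).
Proof.
by move=> cA; rewrite -[A]setCK; apply: measurableC;
  apply: measurable_borelC_open; rewrite openC.
Qed.

Lemma continuous_lipschitz_real (f : C -> R) :
  (forall z w, `|f z - f w| <= cabs (z - w)) -> continuous f.
Proof.
move=> fl z; apply/(@cvgrPdist_lt R R^o _ (nbhs z) (nbhs_filter z)) => e e0.
apply: filterS (nbhs_cabs z e0) => w; exact: le_lt_trans (fl _ _).
Qed.

Lemma continuous_Re : continuous (fun z : C => complex.Re z).
Proof.
by apply: continuous_lipschitz_real => z w; rewrite -raddfB ler_Re_cabs.
Qed.

Lemma continuous_Im : continuous (fun z : C => complex.Im z).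
Proof.
by apply: continuous_lipschitz_real => z w; rewrite -raddfB ler_Im_cabs.
Qed.

Lemma continuous_cabsB (z : C) : continuous (fun w : C => cabs (w - z)).
Proof.
apply: continuous_lipschitz_real => u v; rewrite ler_norml.
have := cabs_sub_ge (u - z) (v - z); have := cabs_sub_ge (v - z) (u - z).
have -> : u - z - (v - z) = u - v by ring.
have -> : v - z - (u - z) = v - u by ring.
by rewrite (cabs_subC v u); lra.
Qed.

Lemma measurable_continuous_borelC (D : set (borelC R)) (f : C -> R) :
  continuous f -> measurable D -> measurable_fun D (f : borelC R -> R).
Proof.
move=> /continuousP cf mD; apply: (@measurable_funS _ _ _ _ setT) => //.
apply: (measurability _ (RGenOpens.measurableE R)).
move=> _ [_ [a [b ->] <-]]; rewrite setTI; apply: measurable_borelC_open.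
exact/cf/interval_open.
Qed.

Lemma closed_unit_circle : closed (@unit_circle R).
Proof.
have -> : @unit_circle R = (fun w : C => cabs (w - 0)) @^-1` [set 1].
  by apply/seteqP; split => z /=; rewrite /unit_circle /= subr0.
by apply: closed_comp => [z _|]; [exact: continuous_cabsB|exact: closed_eq].
Qed.

Lemma measurable_unit_circle : measurable (@unit_circle R : set (borelC R)).
Proof. by apply: measurable_borelC_closed; exact: closed_unit_circle. Qed.

Lemma bmeas_id : bmeas (@unit_circle R : set (borelC R)) (fun w => w).
Proof.
split.
- exact: (measurable_continuous_borelC continuous_Re measurable_unit_circle).
- exact: (measurable_continuous_borelC continuous_Im measurable_unit_circle).
- by exists 1 => w; rewrite /unit_circle /= => ->.
Qed.

Lemma cabs_circle_sub (w z : R[i]) :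
  @unit_circle R w -> 1 - cabs z <= cabs (w - z).
Proof. by move=> <-; exact: cabs_sub_ge. Qed.

End borel_circle.

Section derivative_singular_inner.
Variables (R : realType) (mu : {finite_measure set (borelC R) -> \bar R}).
Local Notation circle := (@unit_circle R : set (borelC R)).
Let mT : measurable circle := @measurable_unit_circle R.

Lemma bmeas_inv_sub z : cabs z < 1 -> bmeas circle (fun w => (w - z)^-1).
Proof.
move=> z1; apply: (bmeasV (e := 1 - cabs z)); first by rewrite subr_gt0.
  by move=> w; exact: cabs_circle_sub.
by apply: bmeasB; [exact: bmeas_id|exact: bmeas_cst].
Qed.

Lemma bmeas_herglotz z : cabs z < 1 ->
  bmeas circle (fun w => (w + z) / (w - z)).
Proof.
move=> z1; apply: bmeasM; last exact: bmeas_inv_sub.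
by apply: bmeasD; [exact: bmeas_id|exact: bmeas_cst].
Qed.

Lemma bmeas_herglotz' z : cabs z < 1 ->
  bmeas circle (fun w => 2 * w / (w - z) ^+ 2).
Proof.
move=> z1; under eq_fun do rewrite expr2 invfM.
apply: bmeasM; last by apply: bmeasM; exact: bmeas_inv_sub.
by apply: bmeasM; [exact: bmeas_cst|exact: bmeas_id].
Qed.

(** The kernel [(w + z) / (w - z)] is expanded to first order in [z] under the
   integral sign; its remainder [2 w h^2 / ((w - z)^2 (w - z - h))] is quadratic
   in [h] uniformly in [w], because [w] stays at distance at least [1 - |z|]
   from [z]. *)
Lemma derive1_singular_inner (z : R[i]) : cabs z < 1 ->
  derive1 (singular_inner mu) z =
  singular_inner mu z * - Cintegral mu circle (fun w => 2 * w / (w - z) ^+ 2).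
Proof.
move=> z1; set d := 1 - cabs z.
have d0 : 0 < d by rewrite subr_gt0.
apply: (@derive1_cexp R _ z _ (2 * (4 / d ^+ 3) * fine (mu circle)) (d / 2)).
  by rewrite divr_gt0.
move=> h hd.
have hz1 : cabs (h + z) < 1.
  by rewrite (le_lt_trans (ler_cabsD _ _))//; rewrite /d in hd; lra.
have -> : - Cintegral mu circle (fun w => (w + (h + z)) / (w - (h + z)))
    - - Cintegral mu circle (fun w => (w + z) / (w - z))
    - - Cintegral mu circle (fun w => 2 * w / (w - z) ^+ 2) * h =
    - (Cintegral mu circle (fun w => (w + (h + z)) / (w - (h + z)))
    - Cintegral mu circle (fun w => (w + z) / (w - z))
    - h * Cintegral mu circle (fun w => 2 * w / (w - z) ^+ 2)) by ring.
rewrite cabsN -CintegralZ//; last exact: bmeas_herglotz'.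
have bh' := bmeasM (bmeas_cst circle h) (bmeas_herglotz' z1).
have bz := bmeas_herglotz z1; have bhz := bmeas_herglotz hz1.
rewrite -!CintegralB//; last exact: bmeasB.
rewrite [leRHS]mulrAC -(mulrA 2).
apply: ler_cabs_Cintegral => //; first by do ?[apply: bmeasB].
move=> w Tw.
have wz : d <= cabs (w - z) by exact: cabs_circle_sub.
have whz : d / 2 <= cabs (w - (h + z)).
  have := cabs_circle_sub (h + z) Tw; have := ler_cabsD h z.
  by rewrite /d in hd *; lra.
have wz0 : w - z != 0 by rewrite -cabs_eq0; lra.
have whz0 : w - (h + z) != 0 by rewrite -cabs_eq0; lra.
have -> : (w + (h + z)) / (w - (h + z)) - (w + z) / (w - z) -
     h * (2 * w / (w - z) ^+ 2) =
     2 * w * h ^+ 2 / ((w - z) ^+ 2 * (w - (h + z))).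
  by field; rewrite wz0 whz0.
have -> : h ^+ 2 = h * h by [].
have -> : (w - z) ^+ 2 = (w - z) * (w - z) by [].
rewrite !cabsM cabsV !cabsM Tw mulr1.
have -> : cabs (2 : R[i]) = 2.
  by rewrite -[2 : R[i]](rmorph_nat (real_complex R)) cabs_real ger0_norm.
have -> : 4 / d ^+ 3 * cabs h ^+ 2 =
    2 * (cabs h * cabs h) * (d * d * (d / 2))^-1.
  by field; lra.
rewrite ler_wpM2l ?mulr_ge0 ?cabs_ge0//.
rewrite lef_pV2 ?posrE ?mulr_gt0 ?divr_gt0//; try lra.
rewrite !ler_pM ?mulr_ge0//; lra.
Qed.

End derivative_singular_inner.

(** * Lower bound for the derivative away from the support *)

Section kernel_bounds.
Variable R : realType.
Implicit Types (w x z : R[i]) (r : R).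

Lemma unit_circleP w :
  @unit_circle R w -> complex.Re w ^+ 2 + complex.Im w ^+ 2 = 1.
Proof. by rewrite /unit_circle /= -sqr_cabs => ->; rewrite expr1n. Qed.

(** Both real parts depend on [w] and [x] only through [D = |w - x|^2], because
   [|w - r x|^2 = (1 - r)^2 + r D] when [w] and [x] are on the circle. *)
Lemma kernel_identities w x r : @unit_circle R w -> @unit_circle R x ->
  r != 1 -> 0 <= r ->
  let D := cabs (w - x) ^+ 2 in
  let n := (1 - r) ^+ 2 + r * D in
  complex.Re ((w + r%:C * x) / (w - r%:C * x)) = (1 - r ^+ 2) / n /\
  complex.Re (- (r%:C * x) * (2 * w / (w - r%:C * x) ^+ 2)) =
    2 * r * ((1 + r ^+ 2) * D / 2 - (1 - r) ^+ 2) / n ^+ 2.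
Proof.
move: w x => [a b] [c d] /unit_circleP ab /unit_circleP cd r1 r0 D n.
rewrite /= in ab cd.
have DE : D = (a - c) ^+ 2 + (b - d) ^+ 2 by rewrite /D sqr_cabs.
have nDE : n = (1 - r) ^+ 2 + r * ((a - c) ^+ 2 + (b - d) ^+ 2).
  by rewrite /n DE.
rewrite DE; move: n nDE => n nDE {D DE}.
have n0 : 0 < n.
  rewrite nDE ltr_pwDl ?mulr_ge0 ?addr_ge0 ?sqr_ge0//.
  by rewrite exprn_even_gt0//= subr_eq0 eq_sym.
have nE : (a - (r * c - 0 * d)) ^+ 2 + (b - (r * d + 0 * c)) ^+ 2 = n.
  have -> : n = 1 - 2 * r + r ^+ 2 + r * ((a ^+ 2 + b ^+ 2) + (c ^+ 2 + d ^+ 2)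
    - 2 * (a * c + b * d)) by rewrite nDE; ring.
  rewrite ab cd.
  have -> : (a - (r * c - 0 * d)) ^+ 2 + (b - (r * d + 0 * c)) ^+ 2 =
    (a ^+ 2 + b ^+ 2) + r ^+ 2 * (c ^+ 2 + d ^+ 2)
    - 2 * r * (a * c + b * d) by ring.
  by rewrite ab cd; ring.
have n0' : n != 0 by rewrite gt_eqF.
have mE : (a - c) ^+ 2 + (b - d) ^+ 2 = 2 - 2 * (a * c + b * d).
  have -> : (a - c) ^+ 2 + (b - d) ^+ 2 = (a ^+ 2 + b ^+ 2) + (c ^+ 2 + d ^+ 2)
    - 2 * (a * c + b * d) by ring.
  by rewrite ab cd; ring.
split.
  rewrite [LHS]/= nE.
  have -> : (a + (r * c - 0 * d)) * ((a - (r * c - 0 * d)) / n) -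
     (b + (r * d + 0 * c)) * - ((b - (r * d + 0 * c)) / n) =
     ((a ^+ 2 + b ^+ 2) - r ^+ 2 * (c ^+ 2 + d ^+ 2)) / n by field.
  by rewrite ab cd mulr1.
rewrite (expr2 (_ - r%:C * _)) invfM [LHS]/= nE.
set p := a - _; set q := b - _.
have -> : (1 + r ^+ 2) * ((a - c) ^+ 2 + (b - d) ^+ 2) / 2 - (1 - r) ^+ 2 =
   2 * r - (1 + r ^+ 2) * (a * c + b * d) by rewrite mE; field.
have -> : 2 * r * (2 * r - (1 + r ^+ 2) * (a * c + b * d)) =
   2 * (2 * r ^+ 2 * (a ^+ 2 + b ^+ 2) * (c ^+ 2 + d ^+ 2)
     - r * ((a ^+ 2 + b ^+ 2) + r ^+ 2 * (c ^+ 2 + d ^+ 2)) * (a * c + b * d)).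
  by rewrite ab cd; ring.
by rewrite /p /q; field.
Qed.

Lemma kernel_bounds w x r (e : R) : @unit_circle R w -> @unit_circle R x ->
  2^-1 <= r < 1 -> 0 < e -> e <= cabs (w - x) ^+ 2 -> 1 - r <= e / 4 ->
  complex.Re ((w + r%:C * x) / (w - r%:C * x)) <= 1 /\
  (16 * cabs (w - x) ^+ 2)^-1 <=
    complex.Re (- (r%:C * x) * (2 * w / (w - r%:C * x) ^+ 2)).
Proof.
move=> Tw Tx /andP[r2 r1] e0 eD re.
have r0 : 0 <= r by lra.
have rn1 : r != 1 by rewrite lt_eqF.
have [-> ->] := kernel_identities Tw Tx rn1 r0.
set D := _ ^+ 2 in eD *.
have D0 : 0 < D by lra.
have r3 : (1 - r) ^+ 2 <= D / 4.
  by rewrite expr2 (le_trans (ler_piMr _ _))//; lra.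
set n := (1 - r) ^+ 2 + r * D.
have s0 := sqr_ge0 (1 - r).
have rD : D / 2 <= r * D by rewrite mulrC ler_wpM2r// ltW.
have rD2 : r * D <= D by rewrite ler_piMl// ltW.
have n0 : 0 < n by rewrite /n; lra.
split.
  rewrite ler_pdivrMr// mul1r.
  have -> : 1 - r ^+ 2 = (1 - r) * (1 + r) by ring.
  have : (1 - r) * (1 + r) <= (1 - r) * 2 by rewrite ler_wpM2l//; lra.
  by rewrite /n; lra.
have n2 : n ^+ 2 <= 4 * D ^+ 2.
  have -> : 4 * D ^+ 2 = (2 * D) ^+ 2 by ring.
  by rewrite lerXn2r// ?nnegrE /n; lra.
have D16 : 0 < 16 * D by lra.
rewrite ler_pdivlMr ?exprn_gt0// mulrC ler_pdivrMr//.
have : 1 * (D / 4) <= 2 * r * ((1 + r ^+ 2) * D / 2 - (1 - r) ^+ 2).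
  rewrite ler_pM//; [lra|lra|].
  have : 0 <= r ^+ 2 * D by rewrite mulr_ge0 ?sqr_ge0 // ltW.
  have -> : (1 + r ^+ 2) * D / 2 = D / 2 + r ^+ 2 * D / 2 by field.
  by lra.
rewrite mul1r => h.
have : D / 4 * (16 * D) <=
  2 * r * ((1 + r ^+ 2) * D / 2 - (1 - r) ^+ 2) * (16 * D).
  by rewrite ler_wpM2r// mulr_ge0// ltW.
by apply: le_trans; rewrite (le_trans n2)//; lra.
Qed.

End kernel_bounds.

Section lower_bound.
Variables (R : realType) (mu : {finite_measure set (borelC R) -> \bar R}).
Variable E : set (Cplx R).
Hypotheses (cE : closed E) (ET : E `<=` @unit_circle R).
Hypothesis muE : mu (~` E) = 0%E.
Local Notation circle := (@unit_circle R : set (borelC R)).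
Let mT : measurable circle := @measurable_unit_circle R.
Let mE : measurable (E : set (borelC R)) := measurable_borelC_closed cE.

Lemma Rintegral_circle_support (u : borelC R -> R) :
  mu.-integrable circle (EFin \o u) ->
  \int[mu]_(w in circle) u w = \int[mu]_(w in (E : set (borelC R))) u w.
Proof.
move=> iu; rewrite /Rintegral (negligible_integral _ mT iu (N := circle `\` E)).
- by rewrite setDD setIidr.
- exact: measurableD.
apply/eqP; rewrite -measure_le0 -muE; apply: le_measure; rewrite ?inE//.
- exact: measurableD.
  exact: measurableC.
Qed.

(** Near a point at distance at least [sqrt e] from the support the two factors
   of [S' = - S K] are under control at radius [r] once [1 - r] is at most
   [e / 4]: [|S|] is bounded below, and the kernel has a real part of at least a
   constant times [|w - x|^-2], so that no cancellation occurs in [K]. *)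
Lemma cabs_derive1_singular_inner_ge (x : R[i]) (r e rho : R) :
  @unit_circle R x -> 2^-1 <= r < 1 -> 0 < e -> 0 < rho ->
  (forall w, E w -> e <= cabs (w - x) ^+ 2) -> 1 - r <= e / 4 ->
  expR (- fine (mu circle)) *
    (fine (mu (E `&` [set w | cabs (w - x) <= rho])) / (16 * rho ^+ 2)) <=
  cabs (derive1 (singular_inner mu) (r%:C * x)).
Proof.
move=> Tx r12 e0 rho0 eE re; have /andP[r1 r2] := r12.
have z1 : cabs (r%:C * x) < 1.
  by rewrite cabsM cabs_real Tx mulr1 ger0_norm//; lra.
rewrite derive1_singular_inner// cabsM cabsN.
apply: ler_pM; rewrite ?expR_ge0//.
- by rewrite mulr_ge0 ?fine_ge0// invr_ge0 mulr_ge0// sqr_ge0.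
- rewrite cabs_cexp ler_expR raddfN lerN2 /Cintegral /=.
  have ih := integrable_Re mu mT (bmeas_herglotz z1).
  rewrite Rintegral_circle_support//.
  apply: le_trans (_ : \int[mu]_(w in (E : set (borelC R))) 1 <= _).
    apply: le_Rintegral => //.
    - exact: integrableS ih.
    - exact: finite_measure_integrable_cst.
    - move=> w Ew.
      by have [] := kernel_bounds (ET Ew) Tx r12 e0 (eE _ Ew) re.
  rewrite Rintegral_cst// mul1r fine_le ?fin_num_measure//.
  by apply: le_measure; rewrite ?inE.
have bh := bmeas_herglotz' z1.
apply: le_trans (_ : cabs (- (r%:C * x) *
    Cintegral mu circle (fun w => 2 * w / (w - r%:C * x) ^+ 2)) <= _);
  last first.
  by rewrite cabsM cabsN ler_piMl ?cabs_ge0// ltW.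
rewrite -CintegralZ//; apply: le_trans (ler_Re_cabs _).
apply: le_trans (ler_norm _); rewrite /Cintegral /=.
have bh2 := bmeasM (bmeas_cst circle (- (r%:C * x))) bh.
have ih := integrable_Re mu mT bh2.
rewrite Rintegral_circle_support//.
have iE := integrableS mT mE ET ih.
set A := E `&` _.
have mA : measurable (A : set (borelC R)).
  apply: measurable_borelC_closed; apply: closedI => //.
  apply: (@closed_comp _ _ (fun w : Cplx R => cabs (w - x)) [set s | s <= rho]).
    by move=> w _; exact: continuous_cabsB.
  exact: closed_le.
have AE : (A : set (borelC R)) `<=` (E : set (borelC R)) by move=> w [].
have pos w : E w ->
    0 <= complex.Re (- (r%:C * x) * (2 * w / (w - r%:C * x) ^+ 2)).
  move=> Ew; have [_] := kernel_bounds (ET Ew) Tx r12 e0 (eE _ Ew) re.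
  by apply: le_trans; rewrite invr_ge0 mulr_ge0// sqr_ge0.
rewrite -(setDUK AE) Rintegral_setU//; first last.
- by rewrite disj_set2E; apply/eqP; rewrite setDE setICA setICr setI0.
- by rewrite setDUK.
- exact: measurableD.
rewrite -[leLHS]addr0 lerD//; last first.
  by apply: Rintegral_ge0 => w [Ew _]; exact: pos.
rewrite mulrC -Rintegral_cst//; apply: le_Rintegral => //.
- exact: finite_measure_integrable_cst.
- exact: integrableS iE.
move=> w [Ew /= wr].
have [_] := kernel_bounds (ET Ew) Tx r12 e0 (eE _ Ew) re.
apply: le_trans.
have D0 : 0 < cabs (w - x) ^+ 2 by rewrite (lt_le_trans e0)// eE.
have r20 : 0 < rho ^+ 2 by rewrite exprn_gt0.
rewrite lef_pV2 ?posrE ?(mulr_gt0 _ D0) ?(mulr_gt0 _ r20)// ler_wpM2l//.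
by rewrite lerXn2r// ?nnegrE ?cabs_ge0// ltW.
Qed.

End lower_bound.

(** * Closed subsets of the circle and their complementary arcs *)

Section parametrization.
Variable R : realType.
Implicit Types s t u : R.
Local Notation tau := (2 * pi : R).

Lemma tau_gt0 : 0 < tau.
Proof. by rewrite mulr_gt0 ?pi_gt0. Qed.

Lemma unit_circle_cis t : @unit_circle R (cis t).
Proof. by rewrite /unit_circle /= cabs_cis. Qed.

Lemma sqr_cabs_cisB s t : cabs (cis s - cis t) ^+ 2 = 2 - 2 * cos (s - t).
Proof.
rewrite sqr_cabs !cisE /= cosB.
have := cos2Dsin2 s; have := cos2Dsin2 t.
have -> : (cos s - cos t) ^+ 2 + (sin s - sin t) ^+ 2 =
   (cos s ^+ 2 + sin s ^+ 2) + (cos t ^+ 2 + sin t ^+ 2)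
   - 2 * (cos s * cos t + sin s * sin t) by ring.
by move=> -> ->; ring.
Qed.

Lemma ler_cabs_cisB s t : cabs (cis s - cis t) <= 2 * `|s - t|.
Proof.
rewrite -ler_sqr ?nnegrE ?cabs_ge0 ?mulr_ge0// sqr_cabs_cisB exprMn.
rewrite real_normK ?num_real//; have := ler_norm_1Bcos (s - t).
by rewrite ler_norml => /andP[_]; have := sqr_ge0 (s - t); lra.
Qed.

Lemma continuous_cis : continuous (@cis R : R -> Cplx R).
Proof.
move=> t; apply: cvg_Cplx => e e0.
have e2 : 0 < e / 2 by rewrite divr_gt0.
have := @cvgr_dist_lt R R^o _ (nbhs t) (nbhs_filter t) id t cvg_id _ e2.
apply: filterS => s ts; apply: le_lt_trans (ler_cabs_cisB _ _) _.
by rewrite mulrC -ltr_pdivlMr// distrC.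
Qed.

Lemma cos_eq1 u : 0 <= u < tau -> cos u = 1 -> u = 0.
Proof.
move=> /andP[u0 u2] c1.
move: u0; rewrite le_eqVlt => /predU1P[->//|u0].
have uE : u = (u / 2) *+ 2 by rewrite -mulr_natr divfK.
have : 0 < sin (u / 2) by apply: sin_gt0_pi; lra.
have : sin (u / 2) ^+ 2 = 0.
  by have := sin2cos2 (u / 2); move: c1; rewrite {1}uE cos_mulr2n; lra.
by move/eqP; rewrite sqrf_eq0 => /eqP ->; rewrite ltxx.
Qed.

Lemma cis_inj s t : 0 <= s < tau -> 0 <= t < tau -> cis s = cis t -> s = t.
Proof.
wlog st : s t / t <= s => [H s1 t1 e|].
  by have [/H ->//|/ltW/H H'] := leP t s; rewrite (H' t1 s1).
move=> /andP[s0 s1] /andP[t0 t1] e; have := sqr_cabs_cisB s t.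
rewrite e subrr sqr_cabs /= expr0n /= addr0 => c.
suff : s - t = 0 by move/eqP; rewrite subr_eq0 => /eqP.
by apply: cos_eq1; lra.
Qed.

Lemma cis_tau : cis tau = cis 0.
Proof. by rewrite !cisE mulr_natl cos2pi sin2pi cos0 sin0. Qed.

Lemma cis_inj_tau s t : 0 <= s <= tau -> 0 < t < tau -> cis s = cis t -> s = t.
Proof.
move=> /andP[s0]; rewrite le_eqVlt => /predU1P[->|s1] /andP[t0 t1]; last first.
  by apply: cis_inj; lra.
have tau0 := tau_gt0; rewrite cis_tau => /cis_inj t00.
have : 0 = t by apply: t00; lra.
by lra.
Qed.

Lemma cis_surj (w : R[i]) :
  @unit_circle R w -> exists2 t, 0 <= t < tau & w = cis t.
Proof.
have := pi_gt0 R => pi0.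
case: w => a b /unit_circleP /= ab.
have a1 : -1 <= a <= 1.
  rewrite -ler_norml -ler_sqr ?nnegrE// real_normK ?num_real//.
  by rewrite expr1n -ab lerDl sqr_ge0.
have ca : cos (acos a) = a by apply: acosK; rewrite in_itv.
have sa : sin (acos a) = `|b|.
  by rewrite sin_acos// -ab addrC addKr sqrtr_sqr.
have a0 := acos_ge0 a1; have api := acos_lepi a1.
have [b0|b0] := leP 0 b.
  by exists (acos a); [lra|rewrite cisE ca sa ger0_norm].
have an : 0 < acos a.
  rewrite lt_neqAle a0 andbT; apply/eqP => a00.
  by move: sa; rewrite -a00 sin0 ltr0_norm//; lra.
exists (tau - acos a); first by lra.
rewrite cisE cosB sinB mulr_natl cos2pi sin2pi ca sa ltr0_norm//.
by congr Complex; ring.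
Qed.

(** On arguments that differ by at most [pi] the chord is monotone in the
   angle, hence bounded away from zero as soon as the angle is. *)
Lemma sqr_cabs_cisB_ge s t (d : R) : 0 <= d -> d <= `|s - t| <= pi ->
  2 - 2 * cos d <= cabs (cis s - cis t) ^+ 2.
Proof.
move=> d0 /andP[dl lp]; rewrite sqr_cabs_cisB -(cos_norm (s - t)).
suff : cos `|s - t| <= cos d by lra.
have H := @ltr_cos R; rewrite leNgt H -?leNgt// in_itv /= ?d0 ?normr_ge0//=.
exact: le_trans lp.
Qed.

Lemma cos_lt1 (d : R) : 0 < d <= pi -> cos d < 1.
Proof.
move=> /andP[d0 dp]; rewrite -cos0.
by have -> // : (cos d < cos 0) = (0 < d) by apply: ltr_cos;
  rewrite in_itv /= ?lexx ?pi_ge0 ?(ltW d0).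
Qed.

Lemma arc_length_cis (a b : R) : 0 <= a -> b <= tau -> a <= b ->
  arc_length (@cis R @` `]a, b[) = (b - a)%:E.
Proof.
move=> a0 b2 ab; rewrite /arc_length.
have -> : [set t | 0 <= t < tau /\ (@cis R @` `]a, b[) (cis t)] =
    `]a, b[%classic.
  apply/seteqP; split => t /=.
    move=> [t0 [s /=]]; rewrite !in_itv /= => /andP[s1 s2] e.
    suff <- : s = t by rewrite s1.
    by apply: cis_inj e => //; lra.
  rewrite in_itv /= => /andP[t1 t2]; split; first by lra.
  by exists t => //=; rewrite in_itv /= t1.
rewrite lebesgue_measure_itv /= lte_fin; case: ltP => // ba.
have -> : b = a by lra.
by rewrite subrr.
Qed.

End parametrization.

(** A closed subset of the circle is given here by its gaps.  Arguments range
   over the compact interval [[0, 2 pi]], whose two ends are the same point of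
   the circle; no gap contains either of them, so a gap is never split. *)
Section gaps.
Variables (R : realType) (I : choiceType) (D : set I) (a b : I -> R).
Local Notation tau := (2 * pi : R).
Hypothesis a0 : forall i, D i -> 0 <= a i.
Hypothesis b_tau : forall i, D i -> b i <= tau.
Hypothesis ab : forall i, D i -> a i < b i.
Hypothesis disj : trivIset D (fun i => `]a i, b i[%classic).

Definition gap_args : set R := \bigcup_(i in D) `]a i, b i[%classic.
Definition gap_set : set (Cplx R) := @cis R @` (`[0, tau] `\` gap_args).

Let gap_range i (t : R) : D i -> t \in `]a i, b i[ -> 0 <= t < tau.
Proof.
move=> Di; rewrite in_itv /= => /andP[at_ tb].
by have := a0 Di; have := b_tau Di; lra.
Qed.

Lemma gap_set_circle : gap_set `<=` @unit_circle R.
Proof. by move=> _ [t _ <-]; exact: unit_circle_cis. Qed.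

Let compact_cis (A : set R) : compact A -> closed (@cis R @` A : set (Cplx R)).
Proof.
move=> cA; apply: compact_closed; first exact: norm_hausdorff.
apply: continuous_compact => //; apply: continuous_subspaceT.
exact: continuous_cis.
Qed.

Lemma open_gap_args : open gap_args.
Proof. by apply: bigcup_open => i _; exact: interval_open. Qed.

Lemma closed_gap_set : closed gap_set.
Proof.
apply: compact_cis; rewrite setDE; apply: compact_closedI.
  exact: segment_compact.
by apply: open_closedC; exact: open_gap_args.
Qed.

Lemma gap_set_cis (t : R) : 0 <= t < tau -> gap_set (cis t) <-> ~ gap_args t.
Proof.
move=> t0; split => [[s [/= s0 ns] e] gt|ng]; last first.
  by exists t => //; split => //=; rewrite in_itv /=; lra.
move: s0; rewrite in_itv /= => /andP[s0]; rewrite le_eqVlt => /predU1P[s2|s2].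
  move: e; rewrite s2 cis_tau => /cis_inj e.
  have t00 : t = 0 by rewrite -e//; have := tau_gt0 R; lra.
  case: gt => i Di /=; rewrite t00 in_itv /= => /andP[ai _].
  by have := a0 Di; lra.
by apply: ns; rewrite (cis_inj _ t0 e) // s0.
Qed.

Lemma circle_diff_gap_set :
  @unit_circle R `\` gap_set = \bigcup_(i in D) (@cis R @` `]a i, b i[).
Proof.
apply/seteqP; split => w.
  move=> [/cis_surj[t t0 ->]] /(gap_set_cis t0)/contrapT[i Di ti].
  by exists i => //; exists t.
move=> [i Di [t ti <-]]; split; first exact: unit_circle_cis.
rewrite gap_set_cis; last exact: gap_range ti.
by apply; exists i.
Qed.

(** A gap is open and closed in the complement: it is what the image of a
   compact interval, and the complement of the image of a compact set, leave in
   the complement of [gap_set]. *)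
Lemma connected_component_gap i (t : R) : D i -> t \in `]a i, b i[ ->
  connected_component (@unit_circle R `\` gap_set) (cis t) =
  @cis R @` `]a i, b i[.
Proof.
move=> Di ti; set U := _ `\` _; set G : set (Cplx R) := @cis R @` _.
have GU : G `<=` U by rewrite /U circle_diff_gap_set => w Gw; exists i.
have Gt : G (cis t) by exists t.
have tU : U (cis t) by exact: GU.
have cG : connected G.
  apply: connected_continuous_connected.
    by apply/connected_intervalP; exact: interval_is_interval.
  by apply: continuous_subspaceT; exact: continuous_cis.
have GC : G `<=` connected_component U (cis t).
  exact: connected_component_max.
have ends (s : R) : 0 <= s <= tau -> ~ gap_args s -> ~ U (cis s).
  by move=> s0 ns [_]; apply; exists s => //; split => //=.
have Dgap j (s : R) : D j -> s \in `]a i, b i[ -> s \in `]a j, b j[ -> i = j.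
  by move=> Dj si sj; apply: (disj Di Dj); exists s.
have endsG (s : R) : s = a i \/ s = b i -> ~ gap_args s.
  move=> se [j Dj /= sj].
  have [u ui uj] : exists2 u, u \in `]a i, b i[ & u \in `]a j, b j[.
    have abi := ab Di; have abj := ab Dj.
    move: sj; rewrite in_itv /= => /andP[s1 s2]; case: se => se; subst s.
      by exists ((a i + Num.min (b i) (b j)) / 2); rewrite in_itv /=;
        case: (ltP (b i) (b j)) => ?; lra.
    by exists ((b i + Num.max (a i) (a j)) / 2); rewrite in_itv /=;
      case: (ltP (a i) (a j)) => ?; lra.
  move: (Dgap _ _ Dj ui uj) => eij; subst j.
  by move: sj; rewrite in_itv /=; case: se => ->; rewrite ltxx ?andbF.
apply/esym; apply: (component_connected (A := U) (x := cis t)).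
- by exists (cis t).
- exists (~` (@cis R @` (`[0, a i] `|` `[b i, tau]))).
    rewrite openC; apply: compact_cis; apply: compactU; exact: segment_compact.
  apply/seteqP; split => w.
    move=> Gw; split; first exact: GC.
    move: Gw => [s + <-] [u + /cis_inj_tau e]; rewrite /= !in_itv /=.
    have [a0' b2] := (a0 Di, b_tau Di) => /andP[s1 s2] uab.
    have us : u = s by apply: e; [case: uab => /andP[]; lra|lra].
    by move: uab; rewrite us => -[]/andP[]; lra.
  move=> [/connected_component_sub [/cis_surj[u u0 ->] _] nw].
  exists u => //=; rewrite in_itv /= !ltNge -negb_or; apply/negP => uab.
  apply: nw; exists u => //=; rewrite !in_itv /=.
  by case/orP: uab; [left|right]; lra.
- exists (@cis R @` `[a i, b i]).
    by apply: compact_cis; exact: segment_compact.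
  apply/seteqP; split => w.
    move=> Gw; split; first exact: GC.
    by case: Gw => s si <-; exists s => //; exact: subset_itv_oo_cc si.
  move=> [/connected_component_sub Uw [s /= + sw]]; rewrite in_itv /=.
  move=> /andP[s1 s2]; exists s => //=.
  rewrite in_itv /= !lt_neqAle s1 s2 !andbT.
  have [a0' b2] := (a0 Di, b_tau Di).
  apply/andP; split; apply/eqP => se.
    by apply: (ends s) => //; [lra|apply: endsG; left|rewrite sw].
  by apply: (ends s) => //; [lra|apply: endsG; right|rewrite sw].
Qed.

Local Notation gap i := (@cis R @` `]a i, b i[ : set (Cplx R)).

Lemma complementary_arcs_gap_set :
  complementary_arcs gap_set = (fun i => gap i) @` D.
Proof.
rewrite /complementary_arcs; apply/seteqP; split => J.
  move=> [w]; rewrite {1}circle_diff_gap_set => -[i Di [t ti <-]] <-.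
  by exists i => //; rewrite (connected_component_gap Di ti).
move=> [i Di <-]; have ti : (a i + b i) / 2 \in `]a i, b i[.
  by rewrite in_itv /=; have := ab Di; lra.
exists (cis ((a i + b i) / 2)); last exact: (connected_component_gap Di ti).
by rewrite circle_diff_gap_set; exists i => //; exists ((a i + b i) / 2).
Qed.

Lemma gap_inj : set_inj D (fun i => gap i).
Proof.
move=> i j /set_mem Di /set_mem Dj e.
have ti : (a i + b i) / 2 \in `]a i, b i[.
  by rewrite in_itv /=; have := ab Di; lra.
have : gap i (cis ((a i + b i) / 2)) by exists ((a i + b i) / 2).
rewrite e => -[t tj /cis_inj tt]; apply: (disj Di Dj).
exists ((a i + b i) / 2); split => //=.
by rewrite -tt //; [exact: gap_range tj|exact: gap_range ti].
Qed.

Lemma esum_complementary_arcs (s : R) :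
  (\esum_(J in complementary_arcs gap_set) (arc_length J `^ s) =
   \esum_(i in D) ((b i - a i) `^ s)%:E)%E.
Proof.
rewrite complementary_arcs_gap_set esum_image; last exact: gap_inj.
apply: eq_esum => i Di.
by rewrite arc_length_cis ?poweR_EFin ?a0 ?b_tau// ltW ?ab.
Qed.

Lemma arc_length_gap_set : (tau%:E <= \esum_(i in D) (b i - a i)%:E)%E ->
  arc_length gap_set = 0%E.
Proof.
move=> full; apply/eqP; rewrite -measure_le0 /arc_length.
have mG : measurable gap_args by apply: open_measurable; exact: open_gap_args.
have Gtau : (tau%:E <= lebesgue_measure gap_args)%E.
  apply: le_trans full _; apply: ge_ereal_sup => _ [F [fF FD] <-] /=.
  apply: le_trans
    (_ : lebesgue_measure (\bigcup_(i in F) `]a i, b i[%classic) <= _)%E.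
    rewrite measure_fin_bigcup//.
    - apply: lee_fsum => // i Fi.
      suff -> : (b i - a i)%:E = lebesgue_measure `]a i, b i[%classic by [].
      by rewrite lebesgue_measure_itv /= lte_fin ab ?EFinB//; exact: FD.
    - exact: sub_trivIset disj.
  apply: le_measure; rewrite ?inE//.
  - by apply: fin_bigcup_measurable.
  - exact: bigcup_subset.
have Gsub : gap_args `<=` `[0, tau[%classic.
  move=> t [i Di ti]; rewrite /= in_itv /=; exact: gap_range ti.
have -> : [set t | 0 <= t < tau /\ gap_set (cis t)] =
    `[0, tau[%classic `\` gap_args.
  apply/seteqP; split => t /=; rewrite in_itv /= => -[t0 h]; split => //.
    exact/gap_set_cis.
  exact/gap_set_cis.
have tau0 := tau_gt0 R.
rewrite measureD//= ?setIidr// lebesgue_measure_itv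
  /= lte_fin tau0 ?sube0 ?ltry//.
by rewrite sube_le0.
Qed.

End gaps.

(** * An increasing pure jump function *)

Section jump_function.
Variables (R : realType) (b : nat) (l : nat -> R).
Hypothesis b_gt0 : (0 < b)%N.
Hypothesis l_gt0 : forall j, 0 < l j.

Definition ngaps j : nat := 2 ^ (b * j).
Local Notation N j := ((ngaps j)%:R : R).
Definition stage_length j : R := N j * l j.
Local Notation T := stage_length.
Hypothesis stage_lengthS : forall j, 2 * T j.+1 <= T j.

(** For [0 <= x] this counts the jump points of stage [j], the positive odd
   multiples of [1 / (2 N_j)], up to and including [x]. *)
Definition jump_count j (x : R) : int := Num.floor (N j * x + 2^-1).

Definition jump_fun (x : R) : R :=
  limn (series (fun j => l j * (jump_count j x)%:~R)).

Definition jump_point j i : R := (i%:R + 2^-1) / N j.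

Definition total_jump : R := limn (series T).

Local Notation f := jump_fun.
Local Notation jp := jump_point.

Lemma ngaps_gt0 j : 0 < N j.
Proof. by rewrite ltr0n expn_gt0. Qed.

Lemma ngaps_ge1 j : 1 <= N j.
Proof. by rewrite ler1n expn_gt0. Qed.

Lemma stage_length_gt0 j : 0 < T j.
Proof. by rewrite mulr_gt0 ?ngaps_gt0. Qed.

Lemma stage_length_tail m n :
  \sum_(m <= k < m + n) T k <= 2 * T m - 2 * T (m + n)%N.
Proof.
elim: n => [|n IH]; first by rewrite addn0 big_geq// subrr.
rewrite addnS big_nat_recr ?leq_addr//=.
by have := stage_lengthS (m + n); lra.
Qed.

Lemma stage_length_tail_le m n : \sum_(m <= k < n) T k <= 2 * T m.
Proof.
have [nm|mn] := leqP n m.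
  by rewrite big_geq// mulr_ge0// ltW ?stage_length_gt0.
rewrite -(subnKC (ltnW mn)) (le_trans (stage_length_tail _ _))//.
by have := stage_length_gt0 (m + (n - m)); lra.
Qed.

Lemma jump_count_le j x : (jump_count j x)%:~R <= N j * x + 2^-1.
Proof. exact: floor_le. Qed.

Lemma jump_count_gt j x : N j * x - 2^-1 < (jump_count j x)%:~R.
Proof. by have := floorD1_gt (N j * x + 2^-1); rewrite rmorphD /=; lra. Qed.

Lemma jump_count_nd j x y : x <= y -> (jump_count j x <= jump_count j y)%R.
Proof.
by move=> xy; apply: le_floor; rewrite lerD2r ler_wpM2l// ltW// ngaps_gt0.
Qed.

Lemma is_cvg_stage_length : cvgn (series T).
Proof.
apply: nondecreasing_is_cvgn.
  apply/nondecreasing_seqP => n; rewrite /series /= big_nat_recr//= lerDl.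
  exact/ltW/stage_length_gt0.
by exists (2 * T 0%N) => _ [n _ <-]; exact: stage_length_tail_le.
Qed.

Lemma is_cvg_jump_fun x : cvgn (series (fun j => l j * (jump_count j x)%:~R)).
Proof.
apply: normed_cvg; apply: nondecreasing_is_cvgn.
  by apply/nondecreasing_seqP => n; rewrite [leRHS]seriesSr lerDl /=.
exists ((`|x| + 1) * (2 * T 0%N)) => _ [n _ <-]; rewrite /series /=.
apply: le_trans (_ : \sum_(0 <= k < n) (`|x| + 1) * T k <= _); last first.
  by rewrite -mulr_sumr ler_wpM2l ?addr_ge0// stage_length_tail_le.
apply: ler_sum => j _; rewrite /= normrM gtr0_norm//.
have -> : (`|x| + 1) * T j = l j * (N j * `|x| + N j) by rewrite /T; ring.
rewrite ler_pM2l//.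
have := jump_count_le j x; have := jump_count_gt j x; have := ngaps_ge1 j.
have h : `|N j * x| <= N j * `|x| by rewrite normrM ger0_norm// ltW ?ngaps_gt0.
move: h; rewrite !ler_norml => /andP[h1 h2] N1 h3 h4; apply/andP; split; lra.
Qed.

Lemma jump_fun_sub_le x y (c : R) n0 :
  (forall n, (n0 <= n)%N ->
    \sum_(0 <= j < n) l j * ((jump_count j y)%:~R - (jump_count j x)%:~R)
      <= c) ->
  f y - f x <= c.
Proof.
move=> H; rewrite -limB; [|exact: is_cvg_jump_fun..].
apply: limr_le; first by apply: is_cvgB; exact: is_cvg_jump_fun.
exists n0 => // n /= /H; rewrite /series /=; apply: le_trans.
rewrite le_eqVlt !fctE -sumrB; apply/orP; left; apply/eqP.
by apply: eq_bigr => j _; rewrite mulrBr.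
Qed.

Lemma jump_fun_sub_ge x y (c : R) n0 :
  (forall n, (n0 <= n)%N ->
    c <=
    \sum_(0 <= j < n) l j * ((jump_count j y)%:~R - (jump_count j x)%:~R)) ->
  c <= f y - f x.
Proof.
move=> H; rewrite -limB; [|exact: is_cvg_jump_fun..].
apply: limr_ge; first by apply: is_cvgB; exact: is_cvg_jump_fun.
exists n0 => // n /= /H; rewrite /series /= => h; apply: le_trans h _.
rewrite le_eqVlt !fctE -sumrB; apply/orP; left; apply/eqP.
by apply: eq_bigr => j _; rewrite mulrBr.
Qed.

Lemma jump_term_ge0 j x y : x <= y ->
  0 <= l j * ((jump_count j y)%:~R - (jump_count j x)%:~R).
Proof.
move=> xy; rewrite mulr_ge0 ?(ltW (l_gt0 _))//.
by rewrite subr_ge0 ler_int jump_count_nd.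
Qed.

Lemma jump_fun_nd x y : x <= y -> f x <= f y.
Proof.
move=> xy; rewrite -subr_ge0; apply: (@jump_fun_sub_ge _ _ _ 0) => n _.
by apply: sumr_ge0 => j _; exact: jump_term_ge0.
Qed.

Lemma jump_count_point j i : jump_count j (jp j i) = i%:Z + 1.
Proof.
apply/eqP; rewrite floor_eq /jp mulrC divfK ?gt_eqF ?ngaps_gt0//.
by rewrite !rmorphD /= -pmulrn; lra.
Qed.

(** Every stage is nondecreasing, so the increment of [f] is at least that of
   stage [j], which jumps at [jump_point j i]. *)
Lemma jump_fun_jump j i x y : y < jp j i -> jp j i <= x -> f y + l j <= f x.
Proof.
move=> yp px; rewrite addrC -lerBrDr.
apply: (@jump_fun_sub_ge _ _ _ j.+1) => n jn.
have yx : y <= x by lra.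
rewrite (bigD1_seq j) ?mem_index_iota ?iota_uniq//=.
rewrite -[leLHS]addr0 lerD//; last first.
  by apply: sumr_ge0 => k _; exact: jump_term_ge0.
rewrite -[leLHS]mulr1 ler_pM2l//.
have h1 := jump_count_nd j px; rewrite jump_count_point in h1.
have h2 : (jump_count j y <= i%:Z)%R.
  rewrite -ltzD1 floor_lt_int rmorphD /= -pmulrn.
  move: yp; rewrite /jp ltr_pdivlMr ?ngaps_gt0// mulrC; lra.
move: h1 h2; rewrite -(ler_int R) -[(_ <= i%:Z)%R](ler_int R) rmorphD /=; lra.
Qed.

Lemma jump_fun0 : f 0 = 0.
Proof.
rewrite /f (_ : (fun _ => _) = (fun=> 0)).
  rewrite (_ : series _ = (fun=> 0)) ?lim_cst//.
  by apply/funext => n; rewrite /series /= big1.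
apply/funext => j; rewrite (_ : jump_count j 0 = 0) ?mulr0//.
by apply/eqP; rewrite floor_eq mulr0 add0r rmorphD /=; lra.
Qed.

Lemma jump_fun1 : f 1 = total_jump.
Proof.
rewrite /f /total_jump; congr (limn (series _)); apply/funext => j.
have -> : jump_count j 1 = (ngaps j)%:Z.
  by apply/eqP; rewrite floor_eq mulr1 rmorphD /= -pmulrn; lra.
by rewrite -pmulrn mulrC.
Qed.

Lemma total_jump_le2 : T 0%N <= 1 -> total_jump <= 2.
Proof.
move=> T0.
apply: limr_le; first exact: is_cvg_stage_length.
exists 0 => // n _; rewrite /series /= (le_trans (stage_length_tail_le _ _))//.
by rewrite -[leRHS]mulr1 ler_pM2l.
Qed.

Lemma jump_point_itv j i : (i < ngaps j)%N -> 0 < jp j i < 1.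
Proof.
move=> iN; have N0 := ngaps_gt0 j.
have h : 0 < i%:R + 2^-1 :> R by have := ler0n R i; lra.
rewrite /jp divr_gt0//= ltr_pdivrMr// mul1r.
have : (i.+1%:R : R) <= N j by rewrite ler_nat.
by rewrite -natr1; lra.
Qed.

Lemma ngapsD k d : ngaps (k + d) = (ngaps k * ngaps d)%N.
Proof. by rewrite /ngaps mulnDr expnD. Qed.

Lemma ngapsS_half d : exists h, ngaps d.+1 = h.*2.
Proof.
exists (2 ^ (b * d.+1).-1)%N.
by rewrite /ngaps -mul2n -expnS prednK// muln_gt0 b_gt0.
Qed.

(** Between a jump point of stage [j] and the next multiple of [1 / N_j] there
   is no jump point of an earlier stage: those are multiples of [1 / N_j]. *)
Lemma jump_count_const j i k x : (k <= j)%N ->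
  jp j i <= x < jp j i + (2 * N j)^-1 ->
  jump_count k x = jump_count k (jp j i).
Proof.
move=> kj /andP[px xp]; apply/eqP; rewrite eq_le (jump_count_nd _ px) andbT.
have N0 := ngaps_gt0 j.
have xN : N j * x < i%:R + 1.
  move: xp; rewrite -(ltr_pM2l N0) mulrDr /jp [N j * (_ / N j)]mulrC.
  rewrite divfK ?gt_eqF//.
  by rewrite invfM mulrCA divff ?gt_eqF// mulr1; lra.
have pN : N j * jp j i = i%:R + 2^-1 by rewrite /jp mulrC divfK// gt_eqF.
rewrite leNgt; apply/negP; rewrite floor_lt_int.
set m := jump_count k x; have := jump_count_le k x; rewrite -/m => mx pm.
move: kj; rewrite leq_eqVlt => /predU1P[kj|].
  subst k; rewrite pN in pm.
  have : m%:~R < (i%:Z + 2)%:~R :> R by rewrite rmorphD /= -pmulrn; lra.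
  have : (i%:Z + 1)%:~R < m%:~R :> R by rewrite rmorphD /= -pmulrn; lra.
  by rewrite !ltr_int; lia.
move=> kj; have jE : j = (k + (j - k.+1).+1)%N by lia.
have [h hE] := ngapsS_half (j - k.+1).
have NE : N j = N k * h%:R * 2 by rewrite {1}jE ngapsD hE -mul2n !natrM; ring.
have h0 : 0 < h%:R :> R.
  rewrite ltr0n; case: h hE {NE} => //; rewrite /ngaps.
  by case: (2 ^ _)%N (expn_gt0 2 (b * (j - k.+1).+1)).
have : (i%:Z + h%:Z)%:~R < (2 * m * h%:Z)%:~R :> R.
  rewrite rmorphD /= !rmorphM /= -!pmulrn.
  have : (N k * jp j i + 2^-1) * (2 * h%:R) < m%:~R * (2 * h%:R).
    by rewrite ltr_pM2r// mulr_gt0.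
  have -> : (N k * jp j i + 2^-1) * (2 * h%:R) = N k * h%:R * 2 * jp j i + h%:R.
    by field.
  by rewrite -NE pN; lra.
have : (2 * m * h%:Z)%:~R < (i%:Z + h%:Z + 1)%:~R :> R.
  rewrite !rmorphD /= !rmorphM /= -!pmulrn.
  have : m%:~R * (2 * h%:R) <= (N k * x + 2^-1) * (2 * h%:R).
    by rewrite ler_pM2r// mulr_gt0.
  have -> : (N k * x + 2^-1) * (2 * h%:R) = N k * h%:R * 2 * x + h%:R.
    by field.
  by rewrite -NE; lra.
by rewrite !ltr_int; lia.
Qed.

(** Stages up to [j] do not move, and a later stage [k] has at most
   [N_k / (2 N_j) + 1 <= 3 / 2 (N_k / N_j)] jumps on this interval; the total
   lengths of the later stages add up to at most [T_j]. *)
Lemma jump_fun_near j i x : jp j i <= x < jp j i + (2 * N j)^-1 ->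
  f x <= f (jp j i) + 3 / 2 * l j.
Proof.
move=> /[dup] xp' /andP[px xp]; rewrite addrC -lerBlDr.
apply: (@jump_fun_sub_le _ _ _ j.+1) => n jn.
have N0 := ngaps_gt0 j.
rewrite (big_cat_nat (leq0n j.+1) jn)//= big1_seq ?add0r; last first.
  move=> k /andP[_]; rewrite mem_index_iota ltnS => /andP[_ kj].
  by rewrite (jump_count_const (i := i) kj)// subrr mulr0.
apply: le_trans (_ : \sum_(j.+1 <= k < n) 3 / 2 / N j * T k <= _).
  apply: ler_sum_nat => k /andP[jk _].
  have Nk := ngaps_gt0 k.
  have NN : N j <= N k by rewrite ler_nat leq_exp2l// leq_mul2l (ltnW jk) orbT.
  rewrite /T mulrA mulrC ler_pM2r//.
  have := jump_count_le k x; have := jump_count_gt k (jp j i).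
  have : N k * x <= N k * (jp j i + (2 * N j)^-1) by rewrite ler_pM2l// ltW.
  have -> : N k * (jp j i + (2 * N j)^-1) = N k * jp j i + N k / N j / 2.
    by field; rewrite gt_eqF.
  have : 1 <= N k / N j by rewrite ler_pdivlMr// mul1r.
  have -> : 3 / 2 / N j * N k = 3 / 2 * (N k / N j) by ring.
  by lra.
rewrite -mulr_sumr.
apply: le_trans (_ : 3 / 2 / N j * (2 * T j.+1) <= _).
  by rewrite ler_pM2l ?divr_gt0// stage_length_tail_le.
apply: le_trans (_ : 3 / 2 / N j * T j <= _).
  by rewrite ler_pM2l ?divr_gt0.
by rewrite /T mulrA divfK// gt_eqF.
Qed.

(** The odd multiples of [1 / (2 N_j)] and of [1 / (2 N_k)] are disjoint for
   [j < k], since [N_k / N_j] is even. *)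
Lemma jump_point_inj j i j' i' : jp j i = jp j' i' -> j = j' /\ i = i'.
Proof.
wlog jj' : j i j' i' / (j <= j')%N.
  move=> H; have [jj'|/ltnW jj'] := leqP j j'; first exact: H.
  by move=> e; have [-> ->] := H _ _ _ _ jj' (esym e).
move=> e; have := @ngaps_gt0 j; have := @ngaps_gt0 j' => N0' N0.
have e1 : i%:R + 2^-1 = jp j' i' * N j :> R by rewrite -e /jp divfK// gt_eqF.
move: jj'; rewrite leq_eqVlt => /predU1P[jj'|jj'].
  subst j'; split => //; move: e1; rewrite /jp divfK ?gt_eqF// => /addIr/eqP.
  by rewrite eqr_nat => /eqP.
have jE : j' = (j + (j' - j.+1).+1)%N by lia.
have [h hE] := ngapsS_half (j' - j.+1).
have NE : N j' = N j * h%:R * 2 by rewrite {1}jE ngapsD hE -mul2n !natrM; ring.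
have : ((2 * i + 1) * h)%:R = (i'%:R + 2^-1) :> R.
  rewrite natrM natrD natrM.
  have -> : i'%:R + 2^-1 = jp j' i' * N j' by rewrite /jp divfK// gt_eqF.
  by rewrite NE !mulrA -e1; field.
move/(congr1 (fun x : R => x * 2)).
rewrite mulrDl mulVf// -!natrM natr1 => /eqP; rewrite eqr_nat => /eqP; lia.
Qed.

End jump_function.

(** * The Cantor set and its measure *)

Lemma pi_ge2 (R : realType) : 2 <= pi :> R.
Proof.
rewrite leNgt; apply/negP => pi2.
by have := @sin2_gt0 R pi; rewrite pi_gt0 pi2 sinpi ltxx => /(_ isT).
Qed.

Lemma exists_image_measure (d : measure_display) (T : measurableType d)
    (R : realType) (phi : measurableTypeR R -> T) :
  measurable_fun setT phi ->
  exists mu : {finite_measure set T -> \bar R},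
    forall A, measurable A ->
      mu A = lebesgue_measure (`[0%R, 1%R] `&` phi @^-1` A).
Proof.
move=> mphi.
exists (distribution (uniform_prob (@ltr01 R)) (mfun_Sub (mem_set mphi))).
move=> A mA.
transitivity
  (\int[lebesgue_measure]_(x in phi @^-1` A) (uniform_pdf 0 1 x)%:E)%E.
  by [].
rewrite integral_uniform_pdf.
have mp : measurable (phi @^-1` A).
  by rewrite -[X in measurable X]setTI; exact: mphi.
rewrite setIC (eq_integral (cst 1%E)).
  by rewrite integral_cst ?mul1e//; exact: measurableI.
move=> x; rewrite inE => -[/= x01 _].
move: x01; rewrite in_itv /= => x01.
by rewrite /uniform_pdf x01 subr0 invr1.
Qed.

Section staged_sums.
Variables (R : realType) (N : nat -> nat) (u : nat -> R).
Hypothesis u_ge0 : forall j, 0 <= u j.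

(** The pair [(j, i)] stands for the gap number [i] of stage [j], and [None] for
   the one gap outside all stages. *)
Definition staged : set (option (nat * nat)) :=
  [set o | if o is Some k then (k.2 < N k.1)%N else True].

Lemma esum_staged (c : R) : 0 <= c ->
  (\esum_(o in staged) (if o is Some k then u k.1 else c)%:E =
   c%:E + \sum_(j <oo) ((N j)%:R * u j)%:E)%E.
Proof.
move=> c0; rewrite (esumID [set None]); last by move=> [k|] _; rewrite lee_fin.
have -> : staged `&` [set None] = [set None].
  by apply/seteqP; split => o; [case|move=> ->].
rewrite esum_set1 ?lee_fin//; congr (_ + _)%E.
have -> : staged `&` ~` [set None] = Some @` (setT `*`` (fun j => `I_(N j))).
  apply/seteqP; split => [[k|]|_ [k [_ kN] <-]] //=; last by case.
  by case=> kN _; exists k.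
rewrite esum_image; last by move=> x y _ _ [].
rewrite -(esum_esum (a := fun j _ => (u j)%:E)); last first.
  by move=> *; rewrite lee_fin.
rewrite nneseries_esumT; last by move=> j; rewrite lee_fin mulr_ge0.
apply: eq_esum => j _.
rewrite esum_fset; [|exact: finite_II|by move=> *; rewrite lee_fin].
by rewrite -fsbig_ord sumEFin sumr_const card_ord mulr_natl.
Qed.

End staged_sums.

Section cantor_gaps.
Variables (R : realType) (b : nat) (l : nat -> R).
Hypothesis b_gt0 : (0 < b)%N.
Hypothesis l_gt0 : forall j, 0 < l j.
Hypothesis stage_lengthS :
  forall j, 2 * stage_length b l j.+1 <= stage_length b l j.
Hypothesis stage_length0 : stage_length b l 0%N <= 1.
Local Notation N j := ((ngaps b j)%:R : R).
Local Notation f := (jump_fun b l).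
Local Notation jp := (jump_point R b).
Local Notation L := (total_jump b l).
Local Notation tau := (2 * pi : R).

(** The gaps are the jumps of [f], and the interval from its last value [L] to
   [2 pi]. *)
Definition gap_lo (o : option (nat * nat)) : R :=
  if o is Some k then f (jp k.1 k.2) - l k.1 else L.
Definition gap_hi (o : option (nat * nat)) : R :=
  if o is Some k then f (jp k.1 k.2) else tau.
Local Notation D := (staged (ngaps b)).
Local Notation E := (gap_set D gap_lo gap_hi).


Let jump_nd := jump_fun_nd l_gt0 stage_lengthS.
Let jump_jump := jump_fun_jump l_gt0 stage_lengthS.

Lemma total_jump_lt_tau : L < tau.
Proof.
have := total_jump_le2 l_gt0 stage_lengthS stage_length0.
by have := @pi_ge2 R; lra.
Qed.

Lemma jump_fun_itv x : 0 <= x <= 1 -> 0 <= f x <= L.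
Proof.
by move=> /andP[x0 x1]; rewrite -(jump_fun1 b l) -{1}(jump_fun0 b l) !jump_nd.
Qed.

Lemma gap_lo_ge0 o : D o -> 0 <= gap_lo o.
Proof.
case: o => [[j i]|] /= kN; last first.
  by have := @jump_fun_itv 1; rewrite ler01 lexx jump_fun1 => /(_ isT)/andP[].
have /andP[x0 x1] := jump_point_itv R kN.
by have := jump_jump x0 (lexx _); rewrite jump_fun0; lra.
Qed.

Lemma gap_hi_le_total k : (k.2 < ngaps b k.1)%N -> gap_hi (Some k) <= L.
Proof.
move=> kN /=; have /andP[x0 x1] := jump_point_itv R kN.
have : 0 <= jp k.1 k.2 <= 1 by rewrite !ltW.
by move=> /jump_fun_itv /andP[].
Qed.

Lemma gap_hi_le_tau o : D o -> gap_hi o <= tau.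
Proof.
case: o => [k|] //= kN; apply: le_trans (gap_hi_le_total kN) _.
exact/ltW/total_jump_lt_tau.
Qed.

Lemma gap_lo_lt_hi o : D o -> gap_lo o < gap_hi o.
Proof.
case: o => [k|] /= kN; last exact: total_jump_lt_tau.
by rewrite ltrBlDr ltrDl l_gt0.
Qed.

Let gap_sep k k' t : jp k.1 k.2 < jp k'.1 k'.2 ->
  t \in `]gap_lo (Some k), gap_hi (Some k)[ ->
  t \in `]gap_lo (Some k'), gap_hi (Some k')[ -> False.
Proof.
move=> kk; rewrite /= !in_itv /= => /andP[_ t1] /andP[t2 _].
by have := jump_jump kk (lexx _); lra.
Qed.

Lemma trivIset_gaps : trivIset D (fun o => `]gap_lo o, gap_hi o[%classic).
Proof.
move=> [k|] [k'|] //= kN k'N [t []] tk tk'.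
- have [kk|kk|kk] := ltgtP (jp k.1 k.2) (jp k'.1 k'.2).
  + by have := gap_sep kk tk tk'.
  + by have := gap_sep kk tk' tk.
  + have [] := jump_point_inj b_gt0 kk.
    by case: k k' {kN k'N tk tk' kk} => [j i] [j' i'] /= -> ->.
- by exfalso; move: tk tk' (gap_hi_le_total kN); rewrite /= !in_itv /=; lra.
- by exfalso; move: tk tk' (gap_hi_le_total k'N); rewrite /= !in_itv /=; lra.
Qed.

Lemma closed_cantor : closed E.
Proof. exact: closed_gap_set. Qed.

Lemma jump_fun_gap_set x : 0 <= x <= 1 -> E (cis (f x)).
Proof.
move=> x01; have /andP[f0 fL] := jump_fun_itv x01.
have Lt := total_jump_lt_tau.
apply/gap_set_cis; [exact: gap_lo_ge0|lra|].
move=> [[k|] /= kN]; rewrite in_itv /=; last by lra.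
have [px|px] := leP (jp k.1 k.2) x; first by have := jump_nd px; lra.
by have := jump_jump px (lexx _); lra.
Qed.

(** The jumps of [f] add up to [L], so the gaps have total length [2 pi]. *)
Lemma arc_length_cantor : arc_length E = 0%E.
Proof.
apply: arc_length_gap_set; [exact: gap_lo_ge0|exact: gap_hi_le_tau|
  exact: gap_lo_lt_hi|exact: trivIset_gaps|].
have Lt := total_jump_lt_tau.
rewrite (eq_esum (b := fun o =>
    (if o is Some k then l k.1 else tau - L)%:E)); last first.
  by move=> [k|] _ //=; rewrite subKr.
rewrite esum_staged; [|by move=> j; exact/ltW|by rewrite subr_ge0 ltW].
suff -> : (\sum_(j <oo) (N j * l j)%:E = L%:E)%E.
  by rewrite -EFinD subrK.
have := is_cvg_stage_length l_gt0 stage_lengthS => c.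
rewrite -EFin_lim//; congr (limn _); apply/funext => n /=.
by rewrite /series /= sumEFin.
Qed.

Lemma esum_cantor_arcs (s : R) :
  (\esum_(J in complementary_arcs E) (arc_length J `^ s) =
   ((tau - L) `^ s)%:E + \sum_(j <oo) (N j * l j `^ s)%:E)%E.
Proof.
rewrite esum_complementary_arcs; [|exact: gap_lo_ge0|exact: gap_hi_le_tau|
  exact: gap_lo_lt_hi|exact: trivIset_gaps].
rewrite -(@esum_staged R (ngaps b) (fun j => l j `^ s)); first last.
- exact: powR_ge0.
- by move=> j; exact: powR_ge0.
by apply: eq_esum => -[k|] _ //=; rewrite subKr.
Qed.

Lemma l_nonincr j k : (j <= k)%N -> l k <= l j.
Proof.
elim: k => [|k IH]; first by rewrite leqn0 => /eqP ->.
rewrite leq_eqVlt => /predU1P[->//|]; rewrite ltnS => /IH; apply: le_trans.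
have N0 := ngaps_gt0 R b k.+1.
rewrite -(ler_pM2l N0).
have NN : N k <= N k.+1 by rewrite ler_nat leq_exp2l// leq_mul2l leqnSn orbT.
apply: le_trans (_ : N k * l k <= _); last by rewrite ler_pM2r.
have := stage_lengthS k; have := stage_length_gt0 b l_gt0 k.+1.
by rewrite /stage_length; lra.
Qed.

Lemma measurable_cantor_param :
  measurable_fun (setT : set (measurableTypeR R))
    (fun x => cis (f x) : borelC R).
Proof.
apply: (@measurability _ _ (measurableTypeR R) (borelC R) _ _
  (@open (Cplx R))) => //.
move=> _ [A oA <-]; rewrite setTI.
have oB : open (@cis R @^-1` A).
  by move: (@continuous_cis R) => /continuousP; exact.
have := nondecreasing_measurable measurableT jump_nd.
move=> /(_ measurableT _ (open_measurable oB)); rewrite setTI; exact.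
Qed.

Section measure_on_cantor.
Variable mu : {finite_measure set (borelC R) -> \bar R}.
Hypothesis muE : forall A : set (borelC R), measurable A ->
  mu A = lebesgue_measure
    (`[0%R, 1%R] `&` (fun x => cis (f x) : borelC R) @^-1` A).

Let mE : measurable (E : set (borelC R)).
Proof. exact: measurable_borelC_closed closed_cantor. Qed.

Lemma cantor_support : mu (~` E) = 0%E.
Proof.
rewrite muE; last exact: measurableC.
rewrite (_ : _ `&` _ = set0) ?measure0//.
apply/seteqP; split => // x [/= x01]; apply; apply: jump_fun_gap_set.
by move: x01; rewrite in_itv.
Qed.

Lemma cantor_total_mass_le1 : fine (mu (@unit_circle R)) <= 1.
Proof.
have mT := @measurable_unit_circle R.
rewrite -lee_fin fineK ?fin_num_measure// muE//.
rewrite (_ : _ `&` _ = `[0%R, 1%R]%classic); last first.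
  by apply/setIidPl => x _; exact: unit_circle_cis.
by rewrite lebesgue_measure_itv /= lte_fin ltr01 oppr0 adde0.
Qed.

(** The image of [[x, x + 1 / (2 N_j)[], with [x] a jump point of stage [j],
   has mass [1 / (2 N_j)] and lies within [3 l_j / 2] of the end of the gap of
   length [l_j] that [x] creates, hence within [5 l_j / 2] of each of its
   points; a chord is at most twice the difference of the arguments. *)
Lemma mass_near_gap j i t : (i < ngaps b j)%N ->
  f (jp j i) - l j <= t <= f (jp j i) ->
  (2 * N j)^-1 <=
  fine (mu (E `&` [set w | cabs (w - cis t) <= 5 * l j])).
Proof.
move=> iN /andP[t1 t2]; set A := _ `&` _.
have N0 := ngaps_gt0 R b j.
have mA : measurable (A : set (borelC R)).
  apply: measurable_borelC_closed; apply: closedI; first exact: closed_cantor.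
  apply: (@closed_comp _ _ (fun w : Cplx R => cabs (w - cis t))
    [set s | s <= 5 * l j]).
    by move=> w _; exact: continuous_cabsB.
  exact: closed_le.
have /andP[p0 p1] := jump_point_itv R iN.
have p2 : jp j i + (2 * N j)^-1 <= 1.
  have -> : jp j i + (2 * N j)^-1 = (i%:R + 1) / N j.
    by rewrite /jump_point; field; rewrite gt_eqF.
  by rewrite ler_pdivrMr// mul1r natr1 ler_nat.
have d0 : 0 < (2 * N j)^-1 by rewrite invr_gt0 mulr_gt0.
rewrite -lee_fin fineK ?fin_num_measure// muE//.
apply: le_trans (_ : lebesgue_measure
    (`[jp j i, (jp j i + (2 * N j)^-1)%R[%classic : set R) <= _)%E.
  by rewrite lebesgue_measure_itv /= lte_fin ltrDl d0 -EFinB addrAC subrr add0r.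
apply: le_measure; rewrite ?inE//.
  apply: measurableI => //.
  by have := measurable_cantor_param measurableT mA; rewrite setTI.
move=> x /=; rewrite in_itv /= => /andP[x1 x2].
have x01 : 0 <= x <= 1 by lra.
split; first by rewrite in_itv.
split; first exact: jump_fun_gap_set.
rewrite /= (le_trans (ler_cabs_cisB _ _))//.
have := jump_nd x1.
have := @jump_fun_near R b l b_gt0 l_gt0 stage_lengthS j i x.
rewrite x1 x2 => /(_ isT).
move=> u1 u2; have : `|f x - t| <= 5 / 2 * l j by rewrite ler_norml; lra.
by lra.
Qed.

(** In the middle half of a gap of length [l_j] the arguments of points of [E]
   are at distance at least [l_j / 4]; all of them lie in [[0, L]] up to a full
   turn, hence within [pi]. *)
Lemma cantor_chord_ge j i t s : (i < ngaps b j)%N -> 0 <= s < tau ->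
  E (cis s) -> f (jp j i) - 3 / 4 * l j <= t <= f (jp j i) - l j / 4 ->
  l j / 4 <= `|s - t| <= pi.
Proof.
move=> iN s0 Es /andP[t1 t2].
have := l_gt0 j => lj0; have pi2 := @pi_ge2 R.
have L2 := total_jump_le2 l_gt0 stage_lengthS stage_length0.
have fp := gap_hi_le_total (k := (j, i)) iN; rewrite /= in fp.
have f0 := gap_lo_ge0 (o := Some (j, i)) iN; rewrite /= in f0.
move: Es; rewrite gap_set_cis//; last exact: gap_lo_ge0.
move=> ng; have sL : s <= L.
  rewrite leNgt; apply/negP => Ls; apply: ng; exists None => //=.
  by rewrite in_itv /=; lra.
have : s <= f (jp j i) - l j \/ f (jp j i) <= s.
  have [|h1] := leP s (f (jp j i) - l j); first by left.
  have [|h2] := leP (f (jp j i)) s; first by right.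
  by exfalso; apply: ng; exists (Some (j, i)) => //=; rewrite in_itv /= h1.
move=> sg; apply/andP; split.
  by rewrite ler_normr; case: sg => ?; apply/orP; [right|left]; lra.
by rewrite ler_norml; lra.
Qed.

(* The total mass is at most 1, and 800 = 2 * 16 * 5 ^ 2 collects the constants
   of mass_near_gap and of the kernel bound. *)
Let c0 : R := expR (- 1) / 800.

(** The gaps of the stages below [n] are at least [l n] long, so that a single
   radius serves their middle halves at once. *)
Lemma cantor_derive_ge n : exists2 r : R, 0 <= r < 1 &
  forall j i (t : R), (j < n)%N -> (i < ngaps b j)%N ->
    f (jp j i) - 3 / 4 * l j <= t <= f (jp j i) - l j / 4 ->
    c0 / (N j * l j ^+ 2) <=
    cabs (derive1 (singular_inner mu) (r%:C * cis t)).
Proof.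
have ln := l_gt0 n; have pi2 := @pi_ge2 R.
have l1 : l n <= 1.
  apply: le_trans (l_nonincr (leq0n n)) _.
  by move: stage_length0; rewrite /stage_length /ngaps muln0 expn0 mul1r.
pose e := 2 - 2 * cos (l n / 4).
have e0 : 0 < e.
  have := @cos_lt1 R (l n / 4); rewrite /e => h.
  have : cos (l n / 4) < 1 by apply: h; lra.
  by lra.
have m0 : 0 < Num.min 2^-1 (e / 4) by rewrite lt_min invr_gt0 ltr0n divr_gt0.
have [m1 m2] : Num.min 2^-1 (e / 4) <= 2^-1 /\ Num.min 2^-1 (e / 4) <= e / 4.
  by split; rewrite ge_min lexx ?orbT.
exists (1 - Num.min 2^-1 (e / 4)); first by lra.
move=> j i t jn iN ht; have lj := l_gt0 j; have N0 := ngaps_gt0 R b j.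
have rho0 : 0 < 5 * l j by rewrite mulr_gt0.
apply: le_trans (cabs_derive1_singular_inner_ge closed_cantor
  (@gap_set_circle _ _ _ _ _) cantor_support (unit_circle_cis t)
  (r := 1 - Num.min 2^-1 (e / 4)) _ e0 rho0 _ _).
- have mass : (2 * N j)^-1 <=
      fine (mu (E `&` [set w | cabs (w - cis t) <= 5 * l j])).
    by apply: mass_near_gap iN _; lra.
  have -> : c0 / (N j * l j ^+ 2) =
      expR (- 1) * ((2 * N j)^-1 / (16 * (5 * l j) ^+ 2)).
    by rewrite /c0; field; rewrite !gt_eqF.
  have q0 : 0 < 16 * (5 * l j) ^+ 2 by rewrite mulr_gt0// exprn_gt0.
  apply: ler_pM; first exact: expR_ge0.
  - by rewrite divr_ge0 ?invr_ge0 ?mulr_ge0 ?(ltW N0)// ltW.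
  - by rewrite ler_expR lerN2 cantor_total_mass_le1.
  - by rewrite ler_pM2r ?invr_gt0.
- by lra.
- move=> w Ew; have [s s0 ws] := cis_surj (gap_set_circle Ew).
  rewrite ws in Ew *; apply: sqr_cabs_cisB_ge; first by lra.
  have /andP[h ->] := cantor_chord_ge iN s0 Ew ht; rewrite andbT.
  apply: le_trans h; rewrite ler_pM2r ?invr_gt0//.
  exact/l_nonincr/ltnW.
- by lra.
Qed.

(** The integral is restricted to the middle halves, of length [l_j / 2], of the
   gaps of the first [n] stages, which are disjoint. *)
Lemma hardy_mean_cantor_ge (p r : R) n : 0 <= p ->
  measurable_fun `[0, tau]
    (fun t => cabs (derive1 (singular_inner mu) (r%:C * cis t))) ->
  (forall j i (t : R), (j < n)%N -> (i < ngaps b j)%N ->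
    f (jp j i) - 3 / 4 * l j <= t <= f (jp j i) - l j / 4 ->
    c0 / (N j * l j ^+ 2) <=
    cabs (derive1 (singular_inner mu) (r%:C * cis t))) ->
  (((2 * pi)^-1 * \sum_(0 <= j < n)
      N j * (l j / 2 * (c0 / (N j * l j ^+ 2)) `^ p))%:E <=
   hardy_mean p (derive1 (singular_inner mu)) r)%E.
Proof.
move=> p0 mF HF; rewrite /hardy_mean EFinM lee_pmul2l//; last first.
  by rewrite lte_fin invr_gt0 tau_gt0.
set F := fun t => _ : R in mF HF *.
pose K (k : nat * nat) :=
  `[f (jp k.1 k.2) - 3 / 4 * l k.1, f (jp k.1 k.2) - l k.1 / 4]%classic : set R.
pose ks := [seq (j, i) | j <- index_iota 0 n, i <- index_iota 0 (ngaps b j)].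
have ksP k : k \in ks -> (k.1 < n)%N /\ (k.2 < ngaps b k.1)%N.
  case/allpairsPdep => j [i [jn iN ->]] /=.
  by move: jn iN; rewrite !mem_index_iota.
have Kgap k : K k `<=` `]gap_lo (Some k), gap_hi (Some k)[%classic.
  move=> t; rewrite /K /= !in_itv /= => /andP[h1 h2].
  by have := l_gt0 k.1; lra.
have mFp : measurable_fun `[0, tau] (fun t => (F t `^ p)%:E).
  apply/measurable_EFinP; exact: (measurableT_comp (measurable_powR p) mF).
have Ksub : \big[setU/set0]_(k <- ks) K k `<=` `[0, tau]%classic.
  rewrite -bigcup_seq => t [k /= /ksP[_ kN]] /Kgap.
  rewrite /= !in_itv /= => h.
  have := @gap_lo_ge0 (Some k) kN; have := @gap_hi_le_tau (Some k) kN.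
  by rewrite /=; lra.
have mK : measurable (\big[setU/set0]_(k <- ks) K k).
  by apply: bigsetU_measurable => k _; exact: measurable_itv.
apply: le_trans (_ :
    (\int[lebesgue_measure]_(t in \big[setU/set0]_(k <- ks) K k)
    (F t `^ p)%:E <= _)%E); last first.
  have H := @ge0_subset_integral _ _ _ lebesgue_measure _ _ mK
    (measurable_itv _) _ mFp.
  apply: H Ksub.
  by move=> t _; rewrite lee_fin powR_ge0.
rewrite ge0_integral_bigsetU; first last.
- by move=> t _; rewrite lee_fin powR_ge0.
- exact: measurable_funS mFp.
- move=> k k' /= /ksP[_ kN] /ksP[_ k'N] [t [/Kgap tk /Kgap tk']].
  suff [->] : Some k = Some k' by [].
  by apply: trivIset_gaps => //; exists t.
- apply: allpairs_uniq_dep => [|j _|]; rewrite ?iota_uniq//.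
  by move=> [j i] [j' i'] _ _ /= [-> ->].
- by move=> k; exact: measurable_itv.
apply: le_trans (_ : (\sum_(k <- ks)
    (l k.1 / 2 * (c0 / (N k.1 * l k.1 ^+ 2)) `^ p)%:E <= _)%E).
  rewrite sumEFin lee_fin /ks big_allpairs_dep /=.
  apply: ler_sum => j _; rewrite sumr_const_nat subn0 mulr_natl//.
rewrite big_seq [leRHS]big_seq; apply: lee_sum => k /ksP[kn kN].
have lk := l_gt0 k.1; have Nk := ngaps_gt0 R b k.1.
apply: le_trans (_ : (\int[lebesgue_measure]_(t in K k)
    ((c0 / (N k.1 * l k.1 ^+ 2)) `^ p)%:E <= _)%E).
  have lK : lebesgue_measure (K k) = (l k.1 / 2)%:E.
    rewrite /K lebesgue_measure_itv /= lte_fin.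
    have -> : f (jp k.1 k.2) - 3 / 4 * l k.1 < f (jp k.1 k.2) - l k.1 / 4.
      by lra.
    by rewrite -EFinB; congr EFin; field.
  rewrite integral_cst; last exact: measurable_itv.
  by rewrite [X in (_ <= _ * X)%E]lK -EFinM mulrC.
have KU : K k `<=` `[0, tau]%classic.
  move=> t /Kgap; rewrite /= !in_itv /= => h.
  have := @gap_lo_ge0 (Some k) kN; have := @gap_hi_le_tau (Some k) kN.
  by rewrite /=; lra.
apply: ge0_le_integral => //.
- exact: measurable_itv.
- by move=> t _; rewrite lee_fin powR_ge0.
- by apply: measurable_funS mFp => //; exact: measurable_itv.
move=> t; rewrite /K /= in_itv /= => ht; rewrite lee_fin.
have c00 : 0 <= c0 / (N k.1 * l k.1 ^+ 2).
  have c_ge0 : 0 <= c0 := divr_ge0 (expR_ge0 _) (ler0n _ 800).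
  exact: divr_ge0 c_ge0 (mulr_ge0 (ltW Nk) (sqr_ge0 _)).
have nc : c0 / (N k.1 * l k.1 ^+ 2) \is Num.nneg by rewrite nnegrE.
have nF : F t \is Num.nneg by rewrite nnegrE cabs_ge0.
exact: (ge0_ler_powR p0 nc nF (HF _ _ _ kn kN ht)).
Qed.

End measure_on_cantor.
End cantor_gaps.

(** * Choice of the gap lengths *)

Section series.
Variable R : realType.

(** The series telescopes: with [x = ln n] and [y = ln (n + 1)], the tangents of
   the exponential give [n^(-e) - (n + 1)^(-e) >= (n + 1)^(-e) e (y - x)] and
   [y - x >= 1 / (n + 1)]. *)
Lemma sum_riemannR_le (e : R) n : 0 < e ->
  \sum_(0 <= j < n) (j.+1%:R : R) `^ (- (1 + e)) <= 1 + e^-1.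
Proof.
move=> e0; case: n => [|n].
  by rewrite big_geq// addr_ge0// invr_ge0 ltW.
rewrite big_nat_recl//= powR1 lerD2l.
suff : \sum_(0 <= i < n) (i.+2%:R : R) `^ (- (1 + e)) <=
    e^-1 * (1 - (n.+1%:R : R) `^ (- e)).
  by move=> /le_trans; apply; rewrite ler_piMr ?invr_ge0 ?(ltW e0)//.
elim: n => [|n IH]; first by rewrite big_geq// powR1 subrr mulr0.
rewrite big_nat_recr//=.
suff : (n.+2%:R : R) `^ (- (1 + e)) <=
    e^-1 * ((n.+1%:R : R) `^ (- e) - n.+2%:R `^ (- e)).
  by move: IH; rewrite !mulrBr; lra.
have [x xE] : exists x, n.+1%:R = expR x :> R.
  by exists (ln n.+1%:R); rewrite lnK ?posrE.
have [y yE] : exists y, n.+2%:R = expR y :> R.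
  by exists (ln n.+2%:R); rewrite lnK ?posrE.
rewrite mulrC ler_pdivlMr// xE yE -!expRM.
have -> : y * - (1 + e) = y * - e - y by ring.
have -> : x * - e = y * - e + e * (y - x) by ring.
rewrite !expRD -{3}[expR (y * - e)]mulr1 -mulrBr -mulrA ler_pM2l ?expR_gt0//.
have xy : expR y = expR x + 1 by rewrite -xE -yE natr1.
have h1 := expR_ge1Dx (e * (y - x)).
have h2 : expR (- y) <= y - x.
  have := expR_ge1Dx (x - y); rewrite expRD.
  have -> : expR x = expR y - 1 by rewrite xy addrK.
  by rewrite mulrBl mul1r expRxMexpNx_1; lra.
by have := ler_wpM2r (ltW e0) h2; lra.
Qed.

Lemma harmonic_unbounded (M : R) : exists n, M < \sum_(0 <= j < n) (j.+1%:R)^-1.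
Proof.
apply: contrapT => /forallNP H; apply: (@dvg_harmonic R).
apply: nondecreasing_is_cvgn.
  apply/nondecreasing_seqP => n.
  by rewrite [leRHS]seriesSr lerDl /= harmonic_ge0.
by exists M => _ [n _ <-]; rewrite leNgt; apply/negP; exact: H.
Qed.

End series.

Lemma measurable_circle_holomorphic (R : realType) (F : R[i] -> Cplx R)
    (r : R) :
  holomorphic_on (@unit_disk R) F -> 0 <= r < 1 ->
  measurable_fun setT (fun t : R => cabs (F (r%:C * cis t))).
Proof.
move=> hF /andP[r0 r1].
have -> : (fun t : R => cabs (F (r%:C * cis t))) =
    (fun w : Cplx R => cabs (w - 0)) \o
      ((F : Cplx R -> Cplx R) \o (fun t => r%:C * cis t : Cplx R)).
  by apply/funext => u /=; rewrite subr0.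
apply: continuous_measurable_fun => t.
have c1 : {for t, continuous (fun t : R => r%:C * cis t : Cplx R)}.
  apply: cvg_Cplx => e e0.
  have H := @continuous_cis R t _ (nbhs_cabs (cis t : Cplx R) e0).
  apply: (@filterS _ (nbhs t) (nbhs_filter t) _ _ _ H) => u /=.
  apply: le_lt_trans; rewrite -mulrBr cabsM cabs_real ger0_norm//.
  by rewrite cabs_subC ler_piMl ?cabs_ge0// ltW.
have c2 : {for (r%:C * cis t : Cplx R), continuous (F : Cplx R -> Cplx R)}.
  apply/differentiable_continuous/derivable1_diffP; apply: hF.
  by rewrite /unit_disk /= cabsM cabs_real cabs_cis mulr1 ger0_norm.
apply: continuous_comp; first exact: (continuous_comp c1 c2).
exact: continuous_cabsB.
Qed.

Section parameters.
Variables (R : realType) (p : R) (b : nat).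
Hypotheses (p0 : 0 < p) (p2 : p < 1 / 2).
Local Notation s := (1 - p / (1 - p)).
Local Notation N j := ((ngaps b j)%:R : R).

(** The gap length of stage [j], fixed by [N_j l_j^s = (j + 1)^(- 1 / (1 - p))]:
   these numbers are summable, their powers with exponent [1 - p] are not. *)
Definition gap_length j : R :=
  ((j.+1%:R : R) `^ (- (1 - p)^-1) / N j) `^ s^-1.
Local Notation l := gap_length.

Let p_lt : p < 1 - p.
Proof. by have := p2; lra. Qed.

Let q_gt0 : 0 < 1 - 2 * p.
Proof. by have := p_lt; lra. Qed.

Let r_gt0 : 0 < 1 - p.
Proof. exact: lt_trans p_lt. Qed.

Let neqs : (p != 0) * (1 - p != 0) * (1 - 2 * p != 0).
Proof. by rewrite !gt_eqF. Qed.

Let s_def : s = (1 - 2 * p) / (1 - p).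
Proof. by field; rewrite ?neqs. Qed.

Let s_gt0 : 0 < s.
Proof. by rewrite s_def divr_gt0. Qed.

Let base_gt0 j : 0 < (j.+1%:R : R) `^ (- (1 - p)^-1) / N j.
Proof. by rewrite divr_gt0 ?powR_gt0 ?ngaps_gt0. Qed.

Lemma gap_length_gt0 j : 0 < l j.
Proof. by rewrite powR_gt0. Qed.

Lemma gap_lengthE j : N j * l j `^ s = (j.+1%:R : R) `^ (- (1 - p)^-1).
Proof.
rewrite /l -powRrM mulVf ?gt_eqF// powRr1 ?ltW//.
by rewrite mulrC divfK// gt_eqF// ngaps_gt0.
Qed.

Lemma gap_length_stage0 : stage_length b l 0%N <= 1.
Proof.
by rewrite /stage_length /l /ngaps muln0 expn0 powR1 divr1 powR1 mulr1.
Qed.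

(** From one stage to the next [N_j] grows by [B = 2^b], and [l_j] shrinks at
   least by [B^(- 1 / s)]; as [1 / s = 1 + p / (1 - 2 p)], the product shrinks
   at least by [2^(- b p / (1 - 2 p))]. *)
Lemma gap_length_stageS j : (1 - 2 * p) / p <= b%:R ->
  2 * stage_length b l j.+1 <= stage_length b l j.
Proof.
rewrite ler_pdivrMr// => bp.
pose B : R := 2 ^+ b.
have B0 : 0 < B by rewrite exprn_gt0.
have NS : N j.+1 = N j * B by rewrite /ngaps mulnSr expnD natrM (natrX _ 2 b).
have N0 := ngaps_gt0 R b j; have l0 := gap_length_gt0 j.
have lS : l j.+1 <= l j * B^-1 `^ s^-1.
  rewrite /l -powRM ?invr_ge0 ?(ltW B0) ?(ltW (base_gt0 _))//.
  apply: ge0_ler_powR;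
    rewrite ?nnegrE ?invr_ge0 ?(ltW s_gt0) ?(ltW (base_gt0 _))//.
    by rewrite mulr_ge0 ?(ltW (base_gt0 _))// invr_ge0 ltW.
  rewrite NS invfM mulrA ler_pM2r ?invr_gt0// ler_pM2r ?invr_gt0//.
  rewrite !powRN lef_pV2 ?posrE ?powR_gt0//.
  by apply: ge0_ler_powR; rewrite ?nnegrE ?ler_nat// invr_ge0 ltW.
have BB : 2 * (B * B^-1 `^ s^-1) <= 1.
  have -> : B = expR (b%:R * ln 2) by rewrite expRM_natl lnK ?posrE.
  have -> : 2 = expR (ln 2) :> R by rewrite lnK ?posrE.
  rewrite -expRN -expRM -!expRD -[leRHS]expR0 ler_expR expRK.
  have ln2 : 0 < ln 2 :> R by rewrite ln_gt0// ltr1n.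
  have -> : ln 2 + (b%:R * ln 2 + - (b%:R * ln 2) * s^-1) =
    ln 2 * (1 - b%:R * (s^-1 - 1)) by ring.
  have -> : s^-1 - 1 = p / (1 - 2 * p) by rewrite s_def; field; rewrite ?neqs.
  rewrite pmulr_rle0// subr_le0.
  by rewrite mulrA ler_pdivlMr ?mul1r.
rewrite /stage_length NS.
apply: le_trans (_ : 2 * (N j * B * (l j * B^-1 `^ s^-1)) <= _).
  by rewrite ler_pM2l// ler_pM2l ?mulr_gt0.
have -> : 2 * (N j * B * (l j * B^-1 `^ s^-1)) =
   N j * l j * (2 * (B * B^-1 `^ s^-1)) by ring.
by rewrite ler_piMr// mulr_ge0// ltW.
Qed.

(** Both sides have the same powers of [N_j] and [l_j], because
   [s (1 - p) = 1 - 2 p]. *)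
Lemma gap_length_term (c : R) j : 0 < c ->
  N j * (l j / 2 * (c / (N j * l j ^+ 2)) `^ p) = c `^ p / 2 * (j.+1%:R)^-1.
Proof.
move=> c0; have N0 := ngaps_gt0 R b j; have l0 := gap_length_gt0 j.
have -> : (j.+1%:R : R)^-1 = (N j * l j `^ s) `^ (1 - p).
  rewrite gap_lengthE -powRrM mulNr mulVf ?neqs//.
  by rewrite powR_inv1.
have {N0}[u ->] : exists u, N j = expR u by exists (ln (N j)); rewrite lnK.
have {l0}[w ->] : exists w, l j = expR w by exists (ln (l j)); rewrite lnK.
have [v ->] : exists v, c = expR v by exists (ln c); rewrite lnK.
rewrite -expRM_natl -expRD -expRN -expRD -!expRM -expRD -expRM.
have -> : expR u * (expR w / 2 * expR ((v - (u + 2 * w)) * p)) =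
  expR (u + w + (v - (u + 2 * w)) * p) / 2 by rewrite !expRD; field.
have -> : expR (v * p) / 2 * expR ((u + w * s) * (1 - p)) =
  expR (v * p + (u + w * s) * (1 - p)) / 2 by rewrite !expRD; field.
by congr (expR _ / 2); field; rewrite ?neqs.
Qed.

Lemma gap_length_summable :
  (\sum_(j <oo) (N j * l j `^ s)%:E < +oo)%E.
Proof.
have e0 : 0 < p / (1 - p) by rewrite divr_gt0.
apply: le_lt_trans (_ : ((1 + (p / (1 - p))^-1)%:E < +oo)%E); last exact: ltry.
apply: lime_le.
  apply: is_cvg_nneseries => j _ _.
  by rewrite lee_fin mulr_ge0// powR_ge0.
apply: nearW => n; rewrite sumEFin lee_fin.
apply: le_trans (sum_riemannR_le n e0).
apply: ler_sum => j _; rewrite gap_lengthE.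
suff <- : (1 - p)^-1 = 1 + p / (1 - p) by [].
by field; rewrite ?neqs.
Qed.

End parameters.

Theorem lemma5p4 (R : realType) (p : R) (hp0 : 0 < p) (hp2 : p < 1 / 2) :
  exists (mu : {finite_measure set (borelC R) -> \bar R}) (E : set (Cplx R)),
    [/\ closed E /\ E `<=` @unit_circle R,
        mu (~` E) = 0%E,
        arc_length E = 0%E,
        (\esum_(J in complementary_arcs E)
           (arc_length J `^ (1 - p / (1 - p))%R) < +oo)%E &
        ~ Hardy p (derive1 (singular_inner mu))].
Proof.
have q0 : 0 <= (1 - 2 * p) / p by rewrite divr_ge0//; lra.
pose b := Num.bound ((1 - 2 * p) / p).
have b_lt := archi_boundP q0; rewrite -/b in b_lt.
have b_gt0 : (0 < b)%N by rewrite -(ltr0n R) (le_lt_trans q0).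
have l_gt0 := gap_length_gt0 p b.
have lS j := gap_length_stageS hp0 hp2 j (ltW b_lt).
have l0 := gap_length_stage0 p b.
have [mu muE] := exists_image_measure (measurable_cantor_param l_gt0 lS).
pose l := gap_length p b.
exists mu, (gap_set (staged (ngaps b)) (gap_lo b l) (gap_hi b l)).
split.
- by split; [exact: closed_cantor|exact: gap_set_circle].
- exact: cantor_support.
- exact: arc_length_cantor.
- rewrite esum_cantor_arcs// lte_add_pinfty ?ltry//.
  exact: gap_length_summable.
move=> [hol bnd].
have [M HM] : exists M : R, forall r, 0 <= r < 1 ->
    (hardy_mean p (derive1 (singular_inner mu)) r <= M%:E)%E.
  move: bnd; set S := ereal_sup _ => bnd.
  have HS r : 0 <= r < 1 ->
      (hardy_mean p (derive1 (singular_inner mu)) r <= S)%E.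
    by move=> r01; apply: ereal_sup_ubound; exists r.
  case: S bnd HS => [x| |] // _ HS; first by exists x.
  by exists 0 => r /HS/le_trans; apply; exact: leNye.
pose c0 : R := expR (- 1) / 800.
have c00 : 0 < c0 := divr_gt0 (expR_gt0 _) (ltr0Sn _ 799).
pose k := (2 * pi)^-1 * (c0 `^ p / 2).
have k0 : 0 < k by rewrite mulr_gt0 ?invr_gt0 ?tau_gt0// divr_gt0 ?powR_gt0.
have [n] := harmonic_unbounded (M / k).
rewrite ltr_pdivrMr// mulrC => /lt_geF/negP; apply.
have [r r01 Hr] := cantor_derive_ge b_gt0 l_gt0 lS l0 muE n.
(* Membership in the Hardy space includes that the derivative is holomorphic;
   this makes the integrand measurable. *)
have mF : measurable_fun `[0, 2 * pi]
    (fun t : R => cabs (derive1 (singular_inner mu) (r%:C * cis t))).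
  exact: measurable_funTS (measurable_circle_holomorphic hol r01).
have := hardy_mean_cantor_ge b_gt0 l_gt0 lS l0 (ltW hp0) mF Hr.
move=> /le_trans /(_ (HM r r01)).
rewrite lee_fin; apply: le_trans; rewrite le_eqVlt; apply/orP; left; apply/eqP.
rewrite /k -mulrA mulr_sumr; congr (_ * _).
by apply: eq_bigr => j _; rewrite gap_length_term.
Qed.
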